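(* Let $n\in\mathbb N_0$, let $q\in\mathbb C$ with $0<|q|<1$, and let $z,a,b,c,d,e,f\in\mathbb C\setminus\{0\}$ be such that $\max\{|cz|,|c/z|\}<1$, where the parameters are such that no denominator below vanishes. Let $x=\frac12(z+z^{-1})$. Then $$p_n(x;a,b,c,d|q)=\frac{(ae,be,ef,abcf,cz,cz^{-1};q)_\infty}{(ac,bc,cf,abef,ez,ez^{-1};q)_\infty}(ac,bc,cd;q)_n$$ $$\times\sum_{k=0}^\infty c^{k-n}\,\frac{(abef;q)_{2k}(\frac ec,\frac{abef}{q};q)_k}{(\frac{abef}{q};q)_{2k}(q,ae,be,ef,abcf;q)_k}\,p_k(x;a,b,e,f|q)\;{}_4\phi_3\!\left(\begin{matrix}q^{-n},q^{n-1}abcd,cf,\frac{qc}{e}\\ cd,\,q^kabcf,\,q^{1-k}\frac ce\end{matrix};q,q\right),$$ and also $$p_n(x;a,b,c,d|q)=\frac{(ae,be,ef,abcf,cz,cz^{-1};q)_\infty}{(ac,bc,cf,abef,ez,ez^{-1};q)_\infty}\,\frac{(ab,ac,bc,\frac df;q)_n}{(abcf;q)_n}$$ $$\times\sum_{k=0}^\infty f^{\,n-k}\,\frac{(abef;q)_{2k}(\frac{abef}{q};q)_k}{(\frac{abef}{q};q)_{2k}(q,ab,ae,be;q)_k}\,p_k(x;a,b,e,f|q)\;{}_4\phi_3\!\left(\begin{matrix}q^{-k},q^{k-1}abef,cf,\frac{qf}{d}\\ ef,\,q^nabcf,\,q^{1-n}\frac fd\end{matrix};q,q\right).$$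
   Context: $(a;q)_n=\prod_{j=0}^{n-1}(1-aq^j)$, $(a;q)_\infty=\lim_{n\to\infty}(a;q)_n$, $(a_1,\dots,a_k;q)_n=\prod_i(a_i;q)_n$. The series ${}_4\phi_3$ is ${}_4\phi_3\!\left(\begin{matrix}a_1,\dots,a_4\\ b_1,b_2,b_3\end{matrix};q,z\right)=\sum_{k\ge0}\frac{(a_1,\dots,a_4;q)_k}{(q,b_1,b_2,b_3;q)_k}z^k$, with $b_j\notin\{q^{-k}:k\in\mathbb N_0\}$. With $x=\frac12(z+z^{-1})$, the Askey--Wilson polynomials are $$p_n(x;a,b,c,d|q)=a^{-n}(ab,ac,ad;q)_n\,{}_4\phi_3\!\left(\begin{matrix}q^{-n},q^{n-1}abcd,az,az^{-1}\\ ab,ac,ad\end{matrix};q,q\right),$$ which are symmetric in $a,b,c,d$. *)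

(* Defs.v *)
(* The complex numbers are R[i], for R : realType (MathComp-Analysis). *)
From mathcomp Require Import all_boot all_order all_algebra.
From mathcomp Require Import complex ring.
From mathcomp Require Import all_classical all_reals all_analysis.

Set Implicit Arguments.
Unset Strict Implicit.
Unset Printing Implicit Defensive.

Import Order.TTheory GRing.Theory Num.Theory numFieldNormedType.Exports.

Local Open Scope ring_scope.
Local Open Scope complex_scope.
Local Open Scope classical_set_scope.

Section QSeries.
Variable R : realType.
Local Notation C := R[i].

(* The metric topology lives on the alias R[i]^o.  As [limn] is total (with an
   unspecified value on divergent sequences), convergence of a series is the
   separate predicate [csummable]. *)
Definition clim (u : nat -> C) : C := limn (u : nat -> C^o).
Definition csum (u : nat -> C) : C := limn (series (u : nat -> C^o)).
Definition csummable (u : nat -> C) : Prop := cvgn (series (u : nat -> C^o)).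

Definition qpoch (a q : C) (n : nat) : C := \prod_(j < n) (1 - a * q ^+ j).
Definition qpoch_inf (a q : C) : C := clim (qpoch a q).

(* (a_1, ..., a_k; q)_n and (a_1, ..., a_k; q)_oo *)
Definition qpochs (s : seq C) (q : C) (n : nat) : C :=
  \prod_(a <- s) qpoch a q n.
Definition qpochs_inf (s : seq C) (q : C) : C :=
  \prod_(a <- s) qpoch_inf a q.

(* b is not in {q^{-k} : k >= 0}; for q != 0 this says that no (b; q)_n vanishes
   (and, for 0 < |q| < 1, that (b; q)_oo does not vanish). *)
Definition qregular (q b : C) : Prop := forall k : nat, b != q ^- k.

Definition phi43 (a1 a2 a3 a4 b1 b2 b3 q z : C) : C :=
  csum (fun k => qpochs [:: a1; a2; a3; a4] q k
                 / qpochs [:: q; b1; b2; b3] q k * z ^+ k).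

(* p_n((z + z^-1) / 2; a, b, c, d | q) as a function of z *)
Definition askey_wilson_z (n : nat) (z a b c d q : C) : C :=
  a ^- n * qpochs [:: a * b; a * c; a * d] q n
  * phi43 (q ^- n) (q ^ (n%:Z - 1) * a * b * c * d) (a * z) (a * z^-1)
          (a * b) (a * c) (a * d) q q.

(* The formula is invariant under z |-> z^-1, so either root of
   z + z^-1 = 2 x may be used: see [askey_wilsonE]. *)
Definition askey_wilson (n : nat) (x a b c d q : C) : C :=
  askey_wilson_z n (x + sqrtC (x ^+ 2 - 1)) a b c d q.

Lemma askey_wilson_zV n z a b c d q :
  askey_wilson_z n z^-1 a b c d q = askey_wilson_z n z a b c d q.
Proof.
rewrite /askey_wilson_z /phi43 invrK; congr (_ * csum _).
by apply/funext => k; rewrite /qpochs !big_cons (mulrCA (qpoch (a * z^-1) q k)).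
Qed.

Lemma askey_wilsonE n x z a b c d q : z != 0 -> x = (z + z^-1) / 2 ->
  askey_wilson n x a b c d q = askey_wilson_z n z a b c d q.
Proof.
move=> z0 xE; rewrite /askey_wilson; set s := sqrtC _.
have sE : s ^+ 2 = ((z - z^-1) / 2) ^+ 2.
  by rewrite sqrtCK xE; field; rewrite z0.
have /orP[/eqP ->|/eqP ->] : (s == (z - z^-1) / 2) || (s == - ((z - z^-1) / 2)).
- by rewrite -eqf_sqr sE.
- suff -> : x + (z - z^-1) / 2 = z by [].
  by rewrite xE; field; rewrite z0.
- suff -> : x + - ((z - z^-1) / 2) = z^-1 by rewrite askey_wilson_zV.
  by rewrite xE; field; rewrite z0.
Qed.

End QSeries.

(* Main.v *)
Require Import Defs.
From mathcomp Require Import all_boot all_order all_algebra.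
From mathcomp Require Import complex ring lra.
From mathcomp Require Import all_classical all_reals all_analysis.
Import Order.TTheory GRing.Theory Num.Theory numFieldNormedType.Exports.
Local Open Scope ring_scope.
Local Open Scope complex_scope.

(* Write A = abef/q and let phi_k be p_k(x;a,b,e,f|q) divided by a^-k (ab,ae,af;q)_k.
   The case n = 0 of the first formula says that 1 is pref(c) times
     S(c) = sum_k weight(c,k) phi_k.
   The three-term recurrence of phi_k, summed by parts against the weights, gives
     (1 - cz)(1 - c/z)(1 - abcf) S(c) = (1 - ac)(1 - bc)(1 - cf) S(cq).
   Iterating from c and from e, where S(e) = 1 because the series stops after one
   term, and letting the arguments c q^m and e q^m tend to 0, expresses S(c) and
   S(e) = 1 as infinite products times the same value S(0), which evaluates S(c).
   For general n, write p_n(x;a,b,c,d|q) as a 4phi3 in the base (cz, c/z;q)_j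
   (Sears' transformation gives the symmetry in a and c) and expand each
   (cz, c/z;q)_j by the recursion from S(c) to S(cq^j); exchanging the finite
   sum with the series is the first formula.  The second one agrees with it term
   by term: Sears' transformation turns both inner 4phi3 into one and the same
   series, terminating both at n and at k. *)

(** Convergence is governed by a balance: the recurrence of phi_k has the limiting characteristic
    roots az and a/z, so phi_k is O((|a| rho)^k) for every rho > max(|z|, 1/|z|), while the weights
    are O((|c|/|a|)^k). The condition on cz and c/z leaves room for such a rho with |c| rho < 1. The
    relation between S(c) and S(cq) rests on (1 - cz)(1 - c/z) = (1 - ac)(1 - c/a) - c(z + 1/z - a -
    1/a): the last bracket is the eigenvalue of the recurrence, so summation by parts removes z and
    leaves a rational identity between weights. The value S(0) is never computed; it is eliminated
    by cross-multiplication. Reaching it requires a majorant uniform over the shifts c q^m, and an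
    encoding of c^k (e/c;q)_k that is polynomial in c. The number e may lie outside the region where
    the majorant holds; there the shifted series terminate, and e q^m enters the region after
    finitely many shifts. *)

Set Implicit Arguments.
Unset Strict Implicit.
Unset Printing Implicit Defensive.

Import ComplexField.Normc.

(** * Terminating sums *)

Section Qpoch.
Variable R : realType.
Local Notation C := R[i].
Implicit Types (q x y u v w g h : C) (k m n : nat).

Lemma qpoch0 x q : qpoch x q 0 = 1.
Proof. by rewrite /qpoch big_ord0. Qed.

Lemma qpochSr x q n : qpoch x q n.+1 = qpoch x q n * (1 - x * q ^+ n).
Proof. by rewrite /qpoch big_ord_recr. Qed.

Lemma qpochS x q n : qpoch x q n.+1 = (1 - x) * qpoch (x * q) q n.
Proof.
rewrite /qpoch big_ord_recl expr0 mulr1; congr (_ * _).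
by apply: eq_bigr => i _; rewrite /= exprS mulrA.
Qed.

Lemma qpochD x q m n : qpoch x q (m + n) = qpoch x q m * qpoch (x * q ^+ m) q n.
Proof.
rewrite /qpoch big_split_ord; congr (_ * _).
by apply: eq_bigr => i _; rewrite /= exprD mulrA.
Qed.

Lemma qpoch_neq0 q x n : q != 0 -> qregular q x -> qpoch x q n != 0.
Proof.
move=> q0 hx; apply/prodf_neq0 => i _; rewrite subr_eq0 eq_sym.
apply: contra (hx i) => /eqP xq; apply/eqP/(mulIf (expf_neq0 i q0)).
by rewrite xq mulVf // expf_neq0.
Qed.

Lemma qregularM q x m : q != 0 -> qregular q x -> qregular q (x * q ^+ m).
Proof.
move=> q0 hx k; apply: contra (hx (k + m)%N) => /eqP xq.
by rewrite exprD invfM -xq mulfK // expf_neq0.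
Qed.

Lemma qregular_lt1 q x : 0 < `|q| < 1 -> `|x| < 1 -> qregular q x.
Proof.
move=> /andP[q0 q1] hx k; apply: contraTneq hx => ->.
by rewrite normrV ?unitfE ?expf_neq0 -?normr_gt0 // normrX -real_leNgt ?num_real //
  ?invf_ge1 ?exprn_gt0 // exprn_ile1 // ltW.
Qed.

Lemma qpoch_eq0 q n k : q != 0 -> (n < k)%N -> qpoch (q ^- n) q k = 0.
Proof.
move=> q0 nk; rewrite -(subnKC nk) addSnnS qpochD qpochS mulVf ?expf_neq0 //.
by rewrite subrr mul0r mulr0.
Qed.

End Qpoch.

(** * The q-Pfaff-Saalschuetz sums and Sears' transformation *)

Section Sears.
Variable R : realType.
Local Notation C := R[i].
Variable q : C.
Hypothesis hq : 0 < `|q| < 1.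
Implicit Types (x y u v w g h : C) (k m n : nat).

Let q0 : q != 0.
Proof. by rewrite -normr_gt0; case/andP: hq. Qed.

Lemma qpochqq_neq0 n : qpoch q q n != 0.
Proof. by apply: qpoch_neq0 => //; apply: qregular_lt1 => //; case/andP: hq. Qed.

Lemma subr1_qX_neq0 n : 1 - q ^+ n.+1 != 0.
Proof.
have := qpochqq_neq0 n.+1; rewrite qpochSr mulf_eq0 negb_or => /andP[_].
by rewrite -exprS.
Qed.

(* The q-Pfaff-Saalschuetz sum, cleared of the denominators depending on u, v, w. *)
Lemma qsaalschutz u v w n :
  qpoch (v * w) q n * qpoch (u * w) q n =
  \sum_(i < n.+1) qpoch q q n / (qpoch q q i * qpoch q q (n - i))
    * (qpoch u q i * qpoch v q i) * qpoch (u * v * w * q ^+ i) q (n - i)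
    * qpoch w q (n - i) * w ^+ i.
Proof.
pose t j i := qpoch q q j / (qpoch q q i * qpoch q q (j - i))
    * (qpoch u q i * qpoch v q i) * qpoch (u * v * w * q ^+ i) q (j - i)
    * qpoch w q (j - i) * w ^+ i.
rewrite -[RHS]/(\sum_(i < n.+1) t n i).
elim: n => [|j IH].
  by rewrite big_ord1 /t !qpoch0 expr0 !mulr1 divr1.
(* Creative telescoping: from [j] to [j.+1] the product side gains the factor [(1 - u * w * q ^+ j)
   * (1 - v * w * q ^+ j)], and the defect of the summand from this recurrence has closed partial
   sums. The range stops at [j] because [j - j.+1] truncates to 0, so [t j j.+1] is not the 0 it
   should be; [t j.+1 j.+1] is added separately and cancels the remainder. *)
have telescope N : (N <= j)%N ->
  \sum_(i < N.+1) (t j.+1 i - (1 - u * w * q ^+ j) * (1 - v * w * q ^+ j) * t j i)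
  = - (q ^+ (j - N) * (qpoch q q j / (qpoch q q N * qpoch q q (j - N)))
    * (qpoch u q N.+1 * qpoch v q N.+1) * qpoch (u * v * w * q ^+ N) q (j - N)
    * qpoch w q (j - N) * w ^+ N.+1).
  elim: N => [|N IHN] lNj.
    rewrite big_ord1 /t !subn0 !qpoch0 !expr0 !mulr1 !mul1r !divff ?qpochqq_neq0 //.
    by rewrite !mul1r !qpochSr !qpoch0 expr0; ring.
  rewrite big_ord_recr IHN ?(ltnW lNj) //= {IHN}.
  have [m ->] : exists m, j = (N.+1 + m)%N by exists (j - N.+1)%N; rewrite subnKC.
  have -> : (N.+1 + m - N = m.+1)%N by rewrite addSnnS addKn.
  rewrite /t -addnS !addKn.
  rewrite (addnS N.+1 m) (qpochS (u * v * w * q ^+ N)) -(mulrA _ (q ^+ N)) -exprSr.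
  rewrite !(qpochSr _ q m) !(qpochSr _ q N.+1) (qpochSr q q (N.+1 + m)) (qpochSr q q N).
  rewrite !exprD !exprS.
  have H1 := qpochqq_neq0 N; have H2 := qpochqq_neq0 m.
  have := subr1_qX_neq0 N; have := subr1_qX_neq0 m.
  rewrite !exprS; move: (q ^+ N) (q ^+ m) => s y H3 H4.
  field.
  by rewrite H1 H2 H3 H4.
rewrite !qpochSr big_ord_recr /=.
have /eqP := telescope j (leqnn j).
rewrite sumrB -mulr_sumr -IH subr_eq => /eqP ->.
rewrite /t !subnn !qpoch0 expr0 !mulr1 !divff ?qpochqq_neq0 //.
by ring.
Qed.

(* The second q-Pfaff-Saalschuetz sum: the same identity read backwards, again
   without denominators other than (q; q)_i. *)
Lemma qsaalschutz_rev w g h n :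
  \sum_(i < n.+1) qpoch (q ^- n) q i * qpoch (w * g * h * q ^+ n / q) q i
    * qpoch w q i * q ^+ i / qpoch q q i
    * (qpoch (w * g * q ^+ i) q (n - i) * qpoch (w * h * q ^+ i) q (n - i))
  = w ^+ n * (qpoch g q n * qpoch h q n).
Proof.
pose t j i := qpoch (q ^- j) q i * qpoch (w * g * h * q ^+ j / q) q i
    * qpoch w q i * q ^+ i / qpoch q q i
    * (qpoch (w * g * q ^+ i) q (j - i) * qpoch (w * h * q ^+ i) q (j - i)).
rewrite -[LHS]/(\sum_(i < n.+1) t n i).
elim: n => [|j IH].
  by rewrite big_ord1 /t !qpoch0 !expr0 !mulr1 divr1.
have telescope N : (N <= j)%N ->
  \sum_(i < N.+1) (t j.+1 i - w * ((1 - g * q ^+ j) * (1 - h * q ^+ j)) * t j i)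
  = (1 - w * g * h * q ^+ j * q ^+ j) * qpoch w q N.+1
    * (qpoch (w * g * q ^+ N) q (j - N) * qpoch (w * h * q ^+ N) q (j - N))
    * qpoch (w * g * h * q ^+ j) q N * qpoch (q ^- j) q N / qpoch q q N.
  elim: N => [|N IHN] lNj.
    rewrite big_ord1 /t !subn0 !qpoch0 !expr0 !mulr1 !divr1.
    by rewrite !qpochSr !qpoch0 expr0; ring.
  rewrite big_ord_recr IHN ?(ltnW lNj) //= {IHN}.
  have [m ->] : exists m, j = (N.+1 + m)%N by exists (j - N.+1)%N; rewrite subnKC.
  have -> : (N.+1 + m - N = m.+1)%N by rewrite addSnnS addKn.
  rewrite /t -addnS !addKn.
  rewrite (qpochS (w * g * q ^+ N)) -(mulrA _ (q ^+ N)) -exprSr.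
  rewrite (qpochS (w * h * q ^+ N)) -(mulrA _ (q ^+ N)) -exprSr.
  rewrite (qpochS (w * g * h * q ^+ (N.+1 + m) / q)) divfK //.
  rewrite (qpochS (q ^- (N.+1 + m.+1))).
  rewrite (addnS N.+1 m).
  have -> : q ^- (N.+1 + m).+1 * q = q ^- (N.+1 + m).
    by rewrite (exprS _ (N.+1 + m)) invfM mulrAC mulVf // mul1r.
  have -> : w * g * h * q ^+ (N.+1 + m).+1 / q = w * g * h * q ^+ (N.+1 + m).
    by rewrite exprSr mulrA mulfK.
  rewrite !(qpochSr _ q m) !(qpochSr _ q N.+1) !(qpochSr _ q N).
  rewrite ?(exprS q (N.+1 + m)) !exprD !exprS.
  have H1 := qpochqq_neq0 N.
  have := subr1_qX_neq0 N.
  have := expf_neq0 N q0; have := expf_neq0 m q0.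
  rewrite !exprS; move: (q ^+ N) (q ^+ m) => s y H3 H4 H5.
  field.
  by rewrite ?q0 H1 H3 H4 H5.
rewrite big_ord_recr /=.
have /eqP := telescope j (leqnn j).
rewrite sumrB -mulr_sumr IH subr_eq => /eqP ->.
rewrite /t !subnn !qpoch0 !mulr1.
rewrite (qpochS (q ^- j.+1)).
have -> : q ^- j.+1 * q = q ^- j.
  by rewrite exprS invfM mulrAC mulVf // mul1r.
have -> : w * g * h * q ^+ j.+1 / q = w * g * h * q ^+ j by rewrite exprSr mulrA mulfK.
rewrite !(qpochSr _ q j) !exprS.
have H1 := qpochqq_neq0 j.
have := subr1_qX_neq0 j.
have := expf_neq0 j q0.
rewrite !exprS; move: (q ^+ j) => s H3 H4.
field.
by rewrite ?q0 H1 H3 H4.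
Qed.

Lemma sum_triangle (V : nmodType) (F : nat -> nat -> V) n :
  \sum_(i < n.+1) \sum_(j < i.+1) F i j =
  \sum_(j < n.+1) \sum_(m < (n - j).+1) F (j + m)%N j.
Proof.
elim: n => [|n IH]; first by rewrite !big_ord1.
rewrite big_ord_recr IH [RHS]big_ord_recr /= subnn big_ord1 addn0.
rewrite [X in _ + X]big_ord_recr /= addrA -big_split; congr (_ + _).
apply: eq_bigr => j _ /=.
by rewrite subSn ?leq_ord // [RHS]big_ord_recr /= addnS subnKC // leq_ord.
Qed.

Lemma qpoch_neq0_le x k n : (k <= n)%N -> qpoch x q n != 0 -> qpoch x q k != 0.
Proof.
by move=> kn; rewrite -(subnKC kn) qpochD mulf_eq0 negb_or => /andP[].
Qed.

(** Terminating series are kept as finite sums, so that rearranging them raises no question of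
    convergence; [phi43E] identifies them with [phi43]. *)
Definition tphi43 n A x y D E F : C :=
  \sum_(i < n.+1) qpoch (q ^- n) q i * qpoch A q i * (qpoch x q i * qpoch y q i)
    / (qpoch q q i * qpoch D q i * (qpoch E q i * qpoch F q i)) * q ^+ i.

Lemma qpochVX_split n i m : (i + m <= n)%N ->
  qpoch (q ^- n) q (i + m) = qpoch (q ^- n) q i * qpoch (q ^- (n - i)) q m.
Proof.
move=> le_n; rewrite qpochD; congr (_ * qpoch _ q m).
have le_in : (i <= n)%N by rewrite (leq_trans _ le_n) ?leq_addr.
by rewrite -{1}(subnK le_in) exprD invfM -mulrA mulVf ?expf_neq0 // mulr1.
Qed.

(* Sears' transformation; the parametrization solves the balancing condition. *)
Lemma sears n u v w g h :
  qpoch (u * v * w) q n != 0 ->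
  qpoch (w * g) q n != 0 -> qpoch (w * h) q n != 0 ->
  qpoch g q n != 0 -> qpoch h q n != 0 ->
  qpoch (w * g) q n * qpoch (w * h) q n
    * tphi43 n (w * g * h * q ^+ n / q) (v * w) (u * w) (u * v * w) (w * g) (w * h)
  = w ^+ n * (qpoch g q n * qpoch h q n)
    * tphi43 n (w * g * h * q ^+ n / q) u v (u * v * w) g h.
Proof.
move=> D E0 F0 g0 h0; set A := w * g * h * q ^+ n / q.
(* Expand (vw, uw; q)_i by [qsaalschutz] and exchange the two sums; the inner sum is then
   [qsaalschutz_rev] with [g] and [h] shifted by a power of [q]. *)
pose T i j := qpoch (q ^- n) q i * qpoch A q i
  * (qpoch q q i / (qpoch q q j * qpoch q q (i - j))
    * (qpoch u q j * qpoch v q j) * qpoch (u * v * w * q ^+ j) q (i - j)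
    * qpoch w q (i - j) * w ^+ j)
  / (qpoch q q i * qpoch (u * v * w) q i * (qpoch (w * g) q i * qpoch (w * h) q i))
  * q ^+ i.
have -> : tphi43 n A (v * w) (u * w) (u * v * w) (w * g) (w * h) =
    \sum_(i < n.+1) \sum_(j < i.+1) T i j.
  apply: eq_bigr => i _; rewrite qsaalschutz mulr_sumr !mulr_suml.
  by apply: eq_bigr => j _.
rewrite sum_triangle [in RHS]/tphi43 !mulr_sumr; apply: eq_bigr => i _.
have le_in : (i <= n)%N by rewrite leq_ord.
have w_split : w ^+ n = w ^+ i * w ^+ (n - i) by rewrite -exprD subnKC.
have split x : qpoch x q n = qpoch x q i * qpoch (x * q ^+ i) q (n - i).
  by rewrite -{1}(subnKC le_in) qpochD.
move: (D) E0 F0 g0 h0; rewrite w_split !split !mulf_eq0 !negb_or.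
move=> /andP[D0 _] /andP[E0 E1] /andP[F0 F1] /andP[g0 g1] /andP[h0 h1].
have S := qsaalschutz_rev w (g * q ^+ i) (h * q ^+ i) (n - i).
have i0 := qpochqq_neq0 i.
pose K := qpoch (w * g) q i * qpoch (w * h) q i *
  (qpoch (q ^- n) q i * qpoch A q i * (qpoch u q i * qpoch v q i) * w ^+ i * q ^+ i
   / (qpoch q q i * qpoch (u * v * w) q i * (qpoch (w * g) q i * qpoch (w * h) q i))).
transitivity (K * (w ^+ (n - i) *
  (qpoch (g * q ^+ i) q (n - i) * qpoch (h * q ^+ i) q (n - i)))).
  rewrite -S !mulr_sumr; apply: eq_bigr => m _.
  have le_im : (i + m <= n)%N by rewrite -leq_subRL // leq_ord.
  have m0 := qpochqq_neq0 m; have im0 := qpochqq_neq0 (i + m).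
  have splitm x : qpoch (x * q ^+ i) q (n - i) =
      qpoch (x * q ^+ i) q m * qpoch (x * q ^+ (i + m)) q (n - i - m).
    by rewrite -{1}(subnKC (_ : m <= n - i)%N) ?leq_ord // qpochD -mulrA -exprD.
  move: E1 F1; rewrite /T /K !splitm !mulf_eq0 !negb_or.
  move=> /andP[E1 E2] /andP[F1 F2].
  rewrite qpochVX_split // (qpochD A) (qpochD (u * v * w)) (qpochD (w * g)) (qpochD (w * h)).
  rewrite addKn.
  have -> : w * (g * q ^+ i) * (h * q ^+ i) * q ^+ (n - i) / q = A * q ^+ i.
    have qn : q ^+ n = q ^+ i * q ^+ (n - i) by rewrite -exprD subnKC.
    by rewrite /A qn; ring.
  rewrite !exprD !mulrA.
  have := qpoch_neq0_le le_im D; rewrite qpochD mulf_eq0 negb_or => /andP[_ D1].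
  field.
  by rewrite m0 F0 E0 D0 i0 F1 E1 D1 im0.
rewrite /K; field.
by rewrite i0 D0 E0 F0 g0 h0.
Qed.

End Sears.

(** * Convergence over R[i] *)

Section Convergence.
Local Open Scope classical_set_scope.
Variable R : realType.
Local Notation C := R[i].
Implicit Types (u v : nat -> C) (l : C).

Lemma ltc_normc (x : C) (e : R) : (`|x| < e%:C) = (normc x < e).
Proof. by rewrite -ltcR. Qed.

Lemma normc_ge0 (x : C) : 0 <= normc x.
Proof. by case: x => a b; exact: sqrtr_ge0. Qed.

Lemma normc_gt0 (x : C) : x != 0 -> 0 < normc x.
Proof.
by move=> x0; rewrite lt_def normc_ge0 andbT; apply: contra x0 => /eqP/eq0_normc ->.
Qed.

Lemma normcB (x y : C) : normc (x - y) = normc (y - x).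
Proof. by rewrite -normcN opprB. Qed.

Lemma normcX (x : C) n : normc (x ^+ n) = normc x ^+ n.
Proof.
by elim: n => [|n IH]; rewrite ?expr0 ?normc1 // !exprS normcM IH.
Qed.

Lemma normc_sum (F : nat -> C) m n :
  normc (\sum_(m <= i < n) F i) <= \sum_(m <= i < n) normc (F i).
Proof.
elim/big_ind2: _ => [|x1 x2 y1 y2 h1 h2|//]; first by rewrite normc0.
by rewrite (le_trans (le_normcD _ _)) // lerD.
Qed.

Lemma cvgCP u l : (u n : C^o) @[n --> \oo] --> (l : C^o) <->
  normc (u n - l) @[n --> \oo] --> (0 : R).
Proof.
split=> [|] /cvgrPdist_lt ul; apply/cvgrPdist_lt => e e0.
  have e0C : 0 < e%:C by rewrite ltcR.
  have := ul _ e0C; apply: filterS => n.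
  by rewrite ltc_normc sub0r normrN ger0_norm ?normc_ge0 // normcB.
(* A positive element of [R[i]] is real, so a complex epsilon reduces to a real one. *)
have er : e = (complex.Re e)%:C by rewrite RRe_real // gtr0_real.
have e0R : 0 < complex.Re e by rewrite -ltcR -er.
have := ul _ e0R; apply: filterS => n.
by rewrite sub0r normrN ger0_norm ?normc_ge0 // er ltc_normc normcB.
Qed.

Lemma normc_le_ReIm (x : C) : normc x <= `|complex.Re x| + `|complex.Im x|.
Proof.
case: x => a b /=; rewrite -(@ler_pXn2r _ 2) ?nnegrE ?sqrtr_ge0 ?addr_ge0 //.
rewrite sqr_sqrtr ?addr_ge0 ?sqr_ge0 // sqrrD !real_normK ?num_real //.
by rewrite lerD2r lerDl mulrn_wge0 // mulr_ge0.
Qed.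

Lemma Re_le_normc (x : C) : `|complex.Re x| <= normc x.
Proof.
case: x => a b /=; rewrite -sqrtr_sqr ler_wsqrtr // lerDl sqr_ge0 //.
Qed.

Lemma Im_le_normc (x : C) : `|complex.Im x| <= normc x.
Proof.
case: x => a b /=; rewrite -sqrtr_sqr ler_wsqrtr // lerDr sqr_ge0 //.
Qed.

Lemma cvgC_ReIm u l : complex.Re (u n) @[n --> \oo] --> complex.Re l ->
  complex.Im (u n) @[n --> \oo] --> complex.Im l -> (u n : C^o) @[n --> \oo] --> (l : C^o).
Proof.
move=> hRe hIm; apply/cvgCP.
have h0 : `|complex.Re (u n) - complex.Re l| + `|complex.Im (u n) - complex.Im l|
    @[n --> \oo] --> (0 : R).
  rewrite -[0](addr0 (0 : R)); apply: cvgD; rewrite -(normr0 R); apply: cvg_norm.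
    by rewrite -(subrr (complex.Re l)); apply: cvgB => //; exact: cvg_cst.
  by rewrite -(subrr (complex.Im l)); apply: cvgB => //; exact: cvg_cst.
apply: (squeeze_cvgr _ (@cvg_cst _ 0 _ _ _) h0); near=> n.
rewrite normc_ge0 /=; apply: le_trans (normc_le_ReIm _) _.
by case: (u n) => a b; case: (l).
Unshelve. all: by end_near. Qed.

(** Real and imaginary parts are dominated by the norm, hence are absolutely convergent real series;
    completeness is used over the reals only. *)
Lemma csummable_geometric u (K r : R) : 0 <= r < 1 ->
  (forall k, normc (u k) <= K * r ^+ k) -> csummable u.
Proof.
move=> /andP[r0 r1] hu.
have part (f : C -> R) : (forall x, `|f x| <= normc x) ->
    cvgn (series (fun k => f (u k) : R^o)).
  move=> hf; apply: (@normed_cvg _ R^o).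
  have hg : cvgn (series (geometric K r)).
    by apply: is_cvg_geometric_series; rewrite ger0_norm.
  apply: series_le_cvg hg => n //=.
    by rewrite (le_trans _ (hu n)) // normc_ge0.
  by rewrite (le_trans (hf _)).
have hRe := part _ Re_le_normc; have hIm := part _ Im_le_normc.
apply/cvg_ex; exists (lim (series (fun k => complex.Re (u k)) @ \oo)
  +i* lim (series (fun k => complex.Im (u k)) @ \oo))%C.
apply: cvgC_ReIm => /=.
  apply: cvg_trans hRe; apply: near_eq_cvg; near=> n.
  by rewrite /series /= raddf_sum.
apply: cvg_trans hIm; apply: near_eq_cvg; near=> n.
by rewrite /series /= raddf_sum.
Unshelve. all: by end_near. Qed.

Lemma csum_cvg u : csummable u -> (series u n : C^o) @[n --> \oo] --> (csum u : C^o).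
Proof. by []. Qed.

Lemma csumE u l : (series u n : C^o) @[n --> \oo] --> (l : C^o) -> csum u = l.
Proof. exact: (cvg_lim (@norm_hausdorff C C^o)). Qed.

Lemma csum_terminating u n : (forall k, (n < k)%N -> u k = 0) ->
  csummable u /\ csum u = \sum_(k < n.+1) u k.
Proof.
move=> u0; suff h : (series u N : C^o) @[N --> \oo] --> (\sum_(k < n.+1) u k : C^o).
  by split; [apply/cvg_ex; exists (\sum_(k < n.+1) u k)|exact: csumE].
apply: cvg_near_cst; near=> N; rewrite /series /=.
have lt_nN : (n.+1 <= N)%N by near: N; exact: nbhs_infty_ge.
rewrite (big_cat_nat _ lt_nN) //= [X in _ + X]big_nat_cond [X in _ + X]big1 ?addr0.
  by rewrite big_mkord.
by move=> k /andP[/andP[/u0]].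
Unshelve. all: by end_near. Qed.

(** The bound depends on [u] only through [K] and [r], which makes the tails in [tannery] uniformly
    small. *)
Lemma csum_tail u (K r : R) N : 0 <= r < 1 ->
  (forall k, normc (u k) <= K * r ^+ k) ->
  normc (csum u - \sum_(k < N) u k) <= K * r ^+ N / (1 - r).
Proof.
move=> r01 hu; have /andP[r0 r1] := r01.
have hs := csum_cvg (csummable_geometric r01 hu).
have K0 : 0 <= K by have := hu 0; rewrite expr0 mulr1; apply: le_trans; exact: normc_ge0.
apply/ler_addgt0Pr => e e0.
have /cvgCP/cvgrPdist_lt/(_ _ e0) h := hs.
near \oo => M.
have le_NM : (N <= M)%N by near: M; exact: nbhs_infty_ge.
have hM : normc (series u M - csum u) < e.
  have : `|0 - normc (series u M - csum u)| < e by near: M.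
  by rewrite sub0r normrN ger0_norm ?normc_ge0.
have -> : csum u - \sum_(k < N) u k =
    (csum u - series u M) + \sum_(N <= k < M) u k.
  rewrite /series /= (big_cat_nat _ le_NM) //= big_mkord.
  by rewrite opprD addrA subrK.
rewrite (le_trans (le_normcD _ _)) // addrC lerD //; last by rewrite normcB ltW.
rewrite (le_trans (normc_sum _ _ _)) //.
have hgeo : \sum_(N <= k < M) normc (u k) <= \sum_(N <= k < M) K * r ^+ k.
  by apply: ler_sum => k _.
apply: le_trans hgeo _; rewrite -mulr_sumr -mulrA ler_wpM2l //.
rewrite ler_pdivlMr ?subr_gt0 // mulr_suml.
have -> : \sum_(N <= k < M) r ^+ k * (1 - r) = r ^+ N - r ^+ M.
  rewrite (@telescope_sumr_eq _ N M (fun k => - r ^+ k)) //; first by rewrite opprK addrC.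
  by move=> k _; rewrite exprSr; ring.
by rewrite gerBl exprn_ge0.
Unshelve. all: by end_near. Qed.

Lemma cvgC_sum n (F : nat -> nat -> C) (g : nat -> C) :
  (forall k, (k < n)%N -> (F k m : C^o) @[m --> \oo] --> (g k : C^o)) ->
  (\sum_(k < n) F k m : C^o) @[m --> \oo] --> (\sum_(k < n) g k : C^o).
Proof.
elim: n => [|n IH] h.
  by rewrite big_ord0; apply: cvg_near_cst; apply: nearW => m; rewrite big_ord0.
have -> : (fun m => \sum_(k < n.+1) F k m : C^o) = (fun m => \sum_(k < n) F k m : C^o) + F n.
  by apply/funext => m; rewrite big_ord_recr.
rewrite big_ord_recr; apply: cvgD; last exact: h.
by apply: IH => k kn; apply: h; rewrite ltnW.
Qed.

(** Dominated convergence: the common majorant, inherited by the limit [g], makes all tails past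
    some [N] small at once, and only a finite sum has to converge. It gives the limit of S(c
    q^m). *)
Lemma tannery (F : nat -> nat -> C) (g : nat -> C) (K r : R) : 0 <= r < 1 ->
  (forall m k, normc (F m k) <= K * r ^+ k) ->
  (forall k, (F m k : C^o) @[m --> \oo] --> (g k : C^o)) ->
  (csum (F m) : C^o) @[m --> \oo] --> (csum g : C^o).
Proof.
move=> r01 hF hg; have /andP[r0 r1] := r01.
have gK k : normc (g k) <= K * r ^+ k.
  apply/ler_addgt0Pr => e e0.
  have /cvgCP/cvgrPdist_lt/(_ _ e0) h := hg k.
  near \oo => m.
  have : `|0 - normc (F m k - g k)| < e by near: m.
  rewrite sub0r normrN ger0_norm ?normc_ge0 // => hm.
  rewrite -[g k](subrK (F m k)) (le_trans (le_normcD _ _)) // addrC lerD ?hF //.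
  by rewrite normcB ltW.
apply/cvgCP/cvgrPdist_lt => e e0.
have tail0 : K * r ^+ N / (1 - r) @[N --> \oo] --> (0 : R).
  rewrite -(mul0r (1 - r)^-1); apply: cvgMr_tmp; apply: (cvg_geometric K).
  by rewrite ger0_norm.
have e3 : 0 < e / 3 by rewrite divr_gt0.
have /cvgrPdist_lt/(_ _ e3) htail := tail0.
near \oo => N.
have hN : K * r ^+ N / (1 - r) < e / 3.
  have : `|0 - K * r ^+ N / (1 - r)| < e / 3 by near: N.
  by rewrite sub0r normrN; apply: le_lt_trans; exact: ler_norm.
have hsum : (\sum_(k < N) F m k : C^o) @[m --> \oo] --> (\sum_(k < N) g k : C^o).
  by apply: (@cvgC_sum N (fun k m => F m k)) => k _; exact: hg.
have /cvgCP/cvgrPdist_lt/(_ _ e3) hfin := hsum.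
near=> m.
have h1 := csum_tail N r01 (hF m); have h2 := csum_tail N r01 gK.
have h3 : normc (\sum_(k < N) F m k - \sum_(k < N) g k) < e / 3.
  have : `|0 - normc (\sum_(k < N) F m k - \sum_(k < N) g k)| < e / 3 by near: m.
  by rewrite sub0r normrN ger0_norm ?normc_ge0.
rewrite sub0r normrN ger0_norm ?normc_ge0 //.
set Fm := \sum_(k < N) F m k; set gm := \sum_(k < N) g k.
rewrite -/Fm in h1 h3; rewrite -/gm in h2 h3.
have -> : csum (F m) - csum g = (csum (F m) - Fm) + ((Fm - gm) + (gm - csum g)) by ring.
have h4 := le_normcD (csum (F m) - Fm) ((Fm - gm) + (gm - csum g)).
have h5 := le_normcD (Fm - gm) (gm - csum g).
have h6 := normcB gm (csum g).
by lra.
Unshelve. all: by end_near. Qed.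

Lemma seriesZ u (x : C) : series (fun k => x * u k) = (fun n => x * series u n).
Proof. by apply/funext => n; rewrite /series /= mulr_sumr. Qed.

Lemma csummableZ u x : csummable u -> csummable (fun k => x * u k).
Proof.
move=> hu; apply/cvg_ex; exists (x * csum u : C^o); rewrite seriesZ.
by apply: (@cvgMl_tmp C); exact: csum_cvg.
Qed.

Lemma csumZ u x : csummable u -> csum (fun k => x * u k) = x * csum u.
Proof.
move=> hu; apply: csumE; rewrite seriesZ.
by apply: (@cvgMl_tmp C); exact: csum_cvg.
Qed.

(** Phrased as convergence of partial sums, so that it yields both the summability and the value of
    the exchanged sum. *)
Lemma csum_sum n (F : nat -> nat -> C) : (forall i, csummable (F i)) ->
  (series (fun k => \sum_(i < n) F i k) N : C^o) @[N --> \oo]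
  --> (\sum_(i < n) csum (F i) : C^o).
Proof.
move=> hF.
have -> : series (fun k => \sum_(i < n) F i k) = (fun N => \sum_(i < n) series (F i) N).
  by apply/funext => N; rewrite /series /= exchange_big.
apply: (@cvgC_sum n (fun i => series (F i)) (fun i => csum (F i))) => i _.
exact: csum_cvg (hF i).
Qed.

Lemma cvgC_ext u v l l' : u =1 v -> l = l' ->
  (u n : C^o) @[n --> \oo] --> (l : C^o) -> (v n : C^o) @[n --> \oo] --> (l' : C^o).
Proof. by move=> /funext -> ->. Qed.

Lemma cvgCD u v l l' : (u n : C^o) @[n --> \oo] --> (l : C^o) ->
  (v n : C^o) @[n --> \oo] --> (l' : C^o) -> (u n + v n : C^o) @[n --> \oo] --> (l + l' : C^o).
Proof. exact: cvgD. Qed.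

Lemma cvgCM u v l l' : (u n : C^o) @[n --> \oo] --> (l : C^o) ->
  (v n : C^o) @[n --> \oo] --> (l' : C^o) -> (u n * v n : C^o) @[n --> \oo] --> (l * l' : C^o).
Proof. exact: (@cvgM C). Qed.

Lemma cvgCMl x u l : (u n : C^o) @[n --> \oo] --> (l : C^o) ->
  (x * u n : C^o) @[n --> \oo] --> (x * l : C^o).
Proof. exact: (@cvgMl_tmp C). Qed.

Lemma cvgCV u l : l != 0 -> (u n : C^o) @[n --> \oo] --> (l : C^o) ->
  ((u n)^-1 : C^o) @[n --> \oo] --> (l^-1 : C^o).
Proof. exact: (@cvgV C). Qed.

Lemma cvgCK l : (l : C^o) @[_ --> \oo] --> (l : C^o).
Proof. exact: cvg_cst. Qed.

Lemma cvgC_const u l : (forall n, u n = l) -> (u n : C^o) @[n --> \oo] --> (l : C^o).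
Proof. by move=> ul; apply: cvg_near_cst; apply: nearW => n; rewrite ul. Qed.

Lemma cvgC_shift m u l : (u n : C^o) @[n --> \oo] --> (l : C^o) ->
  (u (m + n)%N : C^o) @[n --> \oo] --> (l : C^o).
Proof.
move=> hu; apply: (@cvgC_ext (fun n => u (n + m)%N) _ l l) => //.
  by move=> n; rewrite addnC.
by rewrite (cvg_shiftn m (u : nat -> C^o)).
Qed.

Lemma cvgC_unique u l l' : (u n : C^o) @[n --> \oo] --> (l : C^o) ->
  (u n : C^o) @[n --> \oo] --> (l' : C^o) -> l = l'.
Proof. exact: (@cvg_unique C^o (@norm_hausdorff C C^o)). Qed.
End Convergence.

(** * Infinite q-products: convergence, upper and lower bounds *)

Section InfiniteProduct.
Local Open Scope classical_set_scope.
Variable R : realType.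
Local Notation C := R[i].
Variable q : C.
Hypothesis hq : 0 < `|q| < 1.
Implicit Types (x y : C) (k m n : nat).

Let q0 : q != 0.
Proof. by rewrite -normr_gt0; case/andP: hq. Qed.

Lemma normc_q : 0 < normc q < 1.
Proof. by rewrite -!ltcR. Qed.

Let r := normc q.
Let r0 : 0 < r. Proof. by case/andP: normc_q. Qed.
Let r1 : r < 1. Proof. by case/andP: normc_q. Qed.

Lemma qpoch_le_expR x n : normc (qpoch x q n) <= expR (normc x / (1 - r)).
Proof.
have sr : 0 < 1 - r by rewrite subr_gt0.
set s := normc x / (1 - r); have s0 : 0 <= s by rewrite divr_ge0 ?normc_ge0 // ltW.
(* The exponent is the partial geometric sum of the |x| r^j, from 1 + t <= exp t on each factor; the
   induction needs this sharper form. *)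
suff h : normc (qpoch x q n) <= expR (s * (1 - r ^+ n)).
  rewrite (le_trans h) // ler_expR ler_piMr // gerBl exprn_ge0 // ltW //.
elim: n => [|n IH]; first by rewrite qpoch0 normc1 expr0 subrr mulr0 expR0.
rewrite qpochSr normcM.
have -> : s * (1 - r ^+ n.+1) = s * (1 - r ^+ n) + normc x * r ^+ n.
  by rewrite /s exprS; field; rewrite gt_eqF.
rewrite expRD ler_pM ?normc_ge0 //.
apply: le_trans (le_normcD _ _) _.
rewrite normcN normcM normcX normc1 -/r.
exact: expR_ge1Dx.
Qed.

Lemma cvg_qpoch x : (qpoch x q n : C^o) @[n --> \oo] --> (qpoch_inf x q : C^o).
Proof.
(* The increments of the partial products; they decay geometrically because the products are
   bounded. *)
pose u k := - (x * q ^+ k * qpoch x q k).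
have hu : csummable u.
  apply: (@csummable_geometric _ _ (normc x * expR (normc x / (1 - r))) r).
    by rewrite ltW.
  move=> k; rewrite normcN !normcM normcX -/r mulrAC.
  apply: ler_wpM2r; first by rewrite exprn_ge0 // ltW.
  by rewrite ler_wpM2l ?normc_ge0 // qpoch_le_expR.
have qpochE n : qpoch x q n = 1 + series u n.
  elim: n => [|n IH]; first by rewrite qpoch0 /series /= big_geq // addr0.
  by rewrite qpochSr seriesSr addrA -IH /u; ring.
suff : cvgn (qpoch x q : nat -> C^o) by [].
apply/cvg_ex; exists (1 + csum u : C^o).
rewrite (_ : qpoch x q = (fun n => 1 + series u n)); last by apply/funext => n.
by apply: cvgD; [exact: cvg_cst|exact: csum_cvg].
Qed.

(** If |x|/(1 - |q|) <= 1/2, the Weierstrass inequality prod (1 - t_j) >= 1 - sum t_j keeps the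
    products above 1/2. In general it is applied to the factors after the first [M]; regularity
    keeps the earlier products away from 0. *)
Lemma qpoch_lower x : qregular q x ->
  exists2 d : R, 0 < d & forall n, d <= normc (qpoch x q n).
Proof.
move=> hx; have sr : 0 < 1 - r by rewrite subr_gt0.
have small y n : normc y / (1 - r) <= 2^-1 -> 2^-1 <= normc (qpoch y q n).
  set s := normc y / (1 - r) => hs.
  have s0 : 0 <= s by rewrite divr_ge0 ?normc_ge0 // ltW.
  have rn k : 0 <= r ^+ k <= 1 by rewrite exprn_ge0 ?exprn_ile1 ?ltW.
  suff h : 1 - s * (1 - r ^+ n) <= normc (qpoch y q n).
    apply: le_trans h; have /andP[p0 p1] := rn n.
    have := mulr_ge0 s0 p0; rewrite mulrBr mulr1; lra.
  elim: n => [|n IH]; first by rewrite qpoch0 normc1 expr0 subrr mulr0 subr0.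
  rewrite qpochSr normcM.
  have ht : 1 - s * (1 - r) * r ^+ n <= normc (1 - y * q ^+ n).
    have := le_normcD (1 - y * q ^+ n) (y * q ^+ n).
    rewrite subrK normc1 normcM normcX -/r.
    by rewrite /s divfK ?gt_eqF // => h; lra.
  have /andP[rn0 rn1] := rn n.
  have s1 : s <= 1 by apply: le_trans hs _; rewrite invf_le1 ?ler1n ?ltr0n.
  have sr1 : 0 <= s * (1 - r) <= 1.
    by rewrite (mulr_ge0 s0 (ltW sr)) mulr_ile1 ?(ltW sr) // gerBl (ltW r0).
  have st : 0 <= s * (1 - r) * r ^+ n <= 1.
    by case/andP: sr1 => a0 a1; rewrite (mulr_ge0 a0 rn0) mulr_ile1.
  have sn : 0 <= s * (1 - r ^+ n) <= 1.
    by rewrite mulr_ge0 ?subr_ge0 //= mulr_ile1 ?subr_ge0 ?gerBl.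
  case/andP: st => st0 st1; case/andP: sn => sn0 sn1.
  apply: (@le_trans _ _ ((1 - s * (1 - r ^+ n)) * (1 - s * (1 - r) * r ^+ n))).
    have := mulr_ge0 sn0 st0; rewrite exprS; nra.
  by apply: ler_pM => //; rewrite subr_ge0.
have : (fun m => normc x / (1 - r) * r ^+ m) @ \oo --> (0 : R).
  by apply: cvg_geometric; rewrite gtr0_norm.
move=> /cvgrPdist_lt/(_ 2^-1); rewrite invr_gt0 ltr0n => /(_ isT)[M _ hM].
have hd m : 0 < normc (qpoch x q m).
  rewrite lt_def normc_ge0 andbT; apply/eqP => /eq0_normc/eqP.
  by apply/negP; apply: qpoch_neq0.
have hlow n : normc (qpoch x q M) / 2 <= normc (qpoch x q (M + n)).
  rewrite qpochD normcM ler_pM2l //; apply: small.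
  have := hM M (leqnn M); rewrite /= sub0r normrN => h.
  rewrite normcM normcX -/r mulrAC (le_trans (ler_norm _)) // ltW //.
have : exists2 d : R, 0 < d & forall n, (n < M)%N -> d <= normc (qpoch x q n).
  elim: (M) => [|k [d d0 IH]]; first by exists 1.
  exists (Num.min d (normc (qpoch x q k))); first by rewrite lt_min d0 hd.
  move=> n; rewrite ltnS leq_eqVlt => /orP[/eqP ->|/IH h]; rewrite ge_min ?lexx ?orbT //.
  by rewrite h.
case=> d d0 hd'; exists (Num.min d (normc (qpoch x q M) / 2)).
  by rewrite lt_min d0 divr_gt0.
move=> n; rewrite ge_min; have [/hd' -> //|h] := ltnP n M.
by rewrite -(subnKC h) hlow orbT.
Qed.

Lemma qpoch_inf_neq0 x : qregular q x -> qpoch_inf x q != 0.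
Proof.
move=> /qpoch_lower[d d0 hd]; apply/eqP => x0.
have /cvgCP/cvgrPdist_lt/(_ _ d0)[N _ hN] := @cvg_qpoch x.
have := hN N (leqnn N); rewrite /= x0 subr0 sub0r normrN ger0_norm ?normc_ge0 //.
by rewrite ltNge hd.
Qed.

End InfiniteProduct.

(** * The three-term recurrence *)

Section Recurrence.
Variable R : realType.
Local Notation C := R[i].
Variables q z a b e f : C.
Hypothesis hq : 0 < `|q| < 1.
Hypotheses (z0 : z != 0) (a0 : a != 0).
Hypotheses (hab : qregular q (a * b)) (hae : qregular q (a * e)) (haf : qregular q (a * f)).

Let q0 : q != 0.
Proof. by rewrite -normr_gt0; case/andP: hq. Qed.

Definition aw_par : C := a * b * e * f / q.
Local Notation A := aw_par.
Hypothesis hA : qregular q A.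

Definition aw_phi n : C :=
  tphi43 q n (A * q ^+ n) (a * z) (a * z^-1) (a * b) (a * e) (a * f).

(** [aw_up] and [aw_down] are the classical coefficients A_n and C_n of the Askey-Wilson recurrence
    with parameters a, b, e, f. The factor 1 - q^n makes [aw_down 0] vanish whatever its
    denominator, so that the index [n.-1] is harmless at 0. *)
Definition aw_up n : C :=
  (1 - a * b * q ^+ n) * (1 - a * e * q ^+ n) * (1 - a * f * q ^+ n) * (1 - A * q ^+ n)
  / (a * (1 - A * q ^+ (2 * n)) * (1 - A * q ^+ (2 * n).+1)).

Definition aw_down n : C :=
  a * (1 - q ^+ n) * (1 - b * e * q ^+ n / q) * (1 - b * f * q ^+ n / q)
  * (1 - e * f * q ^+ n / q)
  / ((1 - A * q ^+ (2 * n)) * (1 - A * q ^+ (2 * n) / q)).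

Lemma subr1_regular x n : qregular q x -> 1 - x * q ^+ n != 0.
Proof.
move=> /(qpoch_neq0 n.+1 q0); rewrite qpochSr mulf_eq0 negb_or.
by case/andP.
Qed.

(** After the common factors are taken out, the difference is proportional to (1 - q^(j+1))(1 - A
    q^(2n+1)), and the second factor cancels a denominator of [aw_up]. *)
Lemma aw_up_diff n j :
  aw_up n * (qpoch (q ^- n.+1) q j.+1 * qpoch (A * q ^+ n.+1) q j.+1
             - qpoch (q ^- n) q j.+1 * qpoch (A * q ^+ n) q j.+1)
  = - q ^- n.+1 * (1 - q ^+ j.+1)
    * ((1 - a * b * q ^+ n) * (1 - a * e * q ^+ n) * (1 - a * f * q ^+ n)
       / (a * (1 - A * q ^+ (2 * n))))
    * (qpoch (q ^- n) q j * qpoch (A * q ^+ n) q j * (1 - A * q ^+ n * q ^+ j)).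
Proof.
have An := subr1_regular n hA.
have qA : qpoch (A * q ^+ n.+1) q j.+1 =
    qpoch (A * q ^+ n) q j * (1 - A * q ^+ n * q ^+ j) * (1 - A * q ^+ n * q ^+ j.+1)
    / (1 - A * q ^+ n).
  apply: (mulIf An); rewrite divfK //.
  by rewrite exprSr mulrA mulrC -qpochS !qpochSr.
rewrite qA qpochS.
have -> : q ^- n.+1 * q = q ^- n by rewrite exprS invfM mulrAC mulVf // mul1r.
rewrite (qpochSr (q ^- n)) (qpochSr (A * q ^+ n)) /aw_up.
have := subr1_regular (2 * n) hA; have := subr1_regular (2 * n).+1 hA.
move: An; rewrite !(exprS, mul2n, addnn, exprD) -addnn exprD.
have := expf_neq0 n q0; move: (q ^+ n) (q ^+ j) => s y s0 An A1 A2.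
by field; rewrite a0 s0 q0 An A1 A2.
Qed.

Lemma aw_down_diff n j :
  aw_down n * (qpoch (q ^- n) q j.+1 * qpoch (A * q ^+ n) q j.+1
             - qpoch (q ^- n.-1) q j.+1 * qpoch (A * q ^+ n.-1) q j.+1)
  = (1 - q ^+ j.+1)
    * (a * (1 - b * e * q ^+ n / q) * (1 - b * f * q ^+ n / q) * (1 - e * f * q ^+ n / q)
       / (1 - A * q ^+ (2 * n)))
    * (qpoch (q ^- n) q j * qpoch (A * q ^+ n) q j * (1 - q ^- n * q ^+ j)).
Proof.
case: n => [|n] /=.
  rewrite subrr mulr0 expr0 invr1 mul1r.
  case: j => [|j]; first by rewrite expr0 subrr !mulr0.
  by rewrite (qpochS 1) subrr !mul0r mulr0.
have nz : 1 - q ^- n.+1 != 0.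
  by rewrite subr_eq0 eq_sym invr_eq1 eq_sym -subr_eq0 subr1_qX_neq0.
have qn : q ^- n.+1 * q = q ^- n by rewrite exprS invfM mulrAC mulVf // mul1r.
have -> : qpoch (q ^- n) q j.+1 =
    qpoch (q ^- n.+1) q j * (1 - q ^- n.+1 * q ^+ j) * (1 - q ^- n.+1 * q ^+ j.+1)
    / (1 - q ^- n.+1).
  by apply: (mulIf nz); rewrite divfK // -qn mulrC -qpochS !qpochSr.
rewrite (qpochS (A * q ^+ n)) -(mulrA A) -exprSr.
rewrite (qpochSr (q ^- n.+1)) (qpochSr (A * q ^+ n.+1)) /aw_down.
have := subr1_regular (n + n).+2 hA; have := subr1_regular (n + n).+1 hA.
have -> : (2 * n.+1 = (n + n).+2)%N by rewrite mul2n doubleS addnn.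
have := expf_neq0 n q0; have := subr1_qX_neq0 hq n.
rewrite !exprS !exprD; move: (q ^+ n) (q ^+ j) => s y qs s0 A1 A2.
field.
by rewrite s0 q0 A1 A2 -opprB oppr_eq0 qs.
Qed.

Lemma tphi43_extend n N x y u v w t : (n < N)%N ->
  tphi43 q n t x y u v w =
  \sum_(i < N) qpoch (q ^- n) q i * qpoch t q i * (qpoch x q i * qpoch y q i)
    / (qpoch q q i * qpoch u q i * (qpoch v q i * qpoch w q i)) * q ^+ i.
Proof.
move=> nN; pose F i := qpoch (q ^- n) q i * qpoch t q i * (qpoch x q i * qpoch y q i)
    / (qpoch q q i * qpoch u q i * (qpoch v q i * qpoch w q i)) * q ^+ i.
rewrite /tphi43 -!(big_mkord xpredT F).
rewrite [RHS](big_cat_nat _ nN) //= [X in _ = _ + X]big_nat_cond.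
rewrite [X in _ = _ + X]big1 ?addr0 // => i /andP[/andP[ni _] _].
by rewrite /F qpoch_eq0 // !mul0r.
Qed.

Lemma aw_phi_rec n :
  aw_up n * (aw_phi n.+1 - aw_phi n) - aw_down n * (aw_phi n - aw_phi n.-1)
  = (z + z^-1 - a - a^-1) * aw_phi n.
Proof.
pose X j := qpoch (a * z) q j * qpoch (a * z^-1) q j.
pose W j := qpoch q q j * qpoch (a * b) q j * (qpoch (a * e) q j * qpoch (a * f) q j).
pose c m j := qpoch (q ^- m) q j * qpoch (A * q ^+ m) q j * X j / W j * q ^+ j.
have cE m : (m < n.+2)%N -> aw_phi m = \sum_(j < n.+2) c m j by exact: tphi43_extend.
rewrite !cE ?(leq_ltn_trans (leq_pred _)) //.
apply/eqP; rewrite -subr_eq0 -!sumrB !mulr_sumr -!sumrB; apply/eqP.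
have W0 j : W j != 0.
  by rewrite !mulf_neq0 ?qpochqq_neq0 ?qpoch_neq0.
(* The three series are compared coefficientwise in (az, a/z; q)_j. The partial sums of the defect
   telescope to a product containing (q^-n; q)_N, which vanishes at [N = n.+1], the last index of
   the longest series. *)
have partial N : \sum_(j < N.+1) (aw_up n * (c n.+1 j - c n j)
    - aw_down n * (c n j - c n.-1 j) - (z + z^-1 - a - a^-1) * c n j)
  = qpoch (q ^- n) q N * qpoch (A * q ^+ n) q N * X N.+1 / (W N * a).
  elim: N => [|N IH].
    rewrite big_ord1 /c /W /X !qpoch0 !expr0 !mulr1 !divr1.
    rewrite !qpochSr !qpoch0 !expr0.
    by field; rewrite a0 z0.
  rewrite big_ord_recr IH /=.
  have up := aw_up_diff n N; have down := aw_down_diff n N.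
  set K := X N.+1 / W N.+1 * q ^+ N.+1.
  have -> : aw_up n * (c n.+1 N.+1 - c n N.+1) =
      aw_up n * (qpoch (q ^- n.+1) q N.+1 * qpoch (A * q ^+ n.+1) q N.+1
             - qpoch (q ^- n) q N.+1 * qpoch (A * q ^+ n) q N.+1) * K.
    by rewrite /c /K; ring.
  have -> : aw_down n * (c n N.+1 - c n.-1 N.+1) =
      aw_down n * (qpoch (q ^- n) q N.+1 * qpoch (A * q ^+ n) q N.+1
             - qpoch (q ^- n.-1) q N.+1 * qpoch (A * q ^+ n.-1) q N.+1) * K.
    by rewrite /c /K; ring.
  rewrite up down /c /K.
  have W1 := W0 N.+1; have W2 := W0 N.
  have XS : X N.+2 = X N.+1 * ((1 - a * z * q ^+ N.+1) * (1 - a * z^-1 * q ^+ N.+1)).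
    by rewrite /X !(qpochSr _ q N.+1); ring.
  rewrite XS.
  have WS : W N.+1 = W N *
      ((1 - q * q ^+ N) * (1 - a * b * q ^+ N) * (1 - a * e * q ^+ N) * (1 - a * f * q ^+ N)).
    by rewrite /W !qpochSr; ring.
  move: W1; rewrite WS !mulf_eq0 !negb_or => /andP[_ /andP[/andP[/andP[F1 F2] F3] F4]].
  rewrite !(qpochSr _ q N).
  have := subr1_regular (2 * n) hA; have := expf_neq0 n q0; have := expf_neq0 N q0.
  rewrite mul2n -addnn exprD !exprS.
  move: F1 F2 F3 F4 (W0 N).
  move: (qpoch _ q N) (qpoch _ q N) (X N.+1) (W N) => P Q x w.
  move: (q ^+ n) (q ^+ N) => s y F1 F2 F3 F4 w0 y0 s0 A0.
  move: A0; rewrite /aw_par => A0.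
  have A1 : q - a * b * e * f * (s * s) != 0.
    have -> : q - a * b * e * f * (s * s) = q * (1 - a * b * e * f / q * (s * s)) by field.
    by rewrite mulf_neq0.
  field.
  by rewrite a0 F1 F2 F3 F4 w0 z0 q0 s0 A1.
by rewrite partial qpoch_eq0 // !mul0r.
Qed.
End Recurrence.

(** * Growth of solutions of a perturbed three-term recurrence *)

Section Growth.
Local Open Scope classical_set_scope.
Variable R : realType.
Local Notation C := R[i].

Lemma geometric_bound (u : nat -> R) (K rho : R) n0 : 0 < rho ->
  (forall n, u (n0 + n)%N <= K * rho ^+ n) -> exists K', forall n, u n <= K' * rho ^+ n.
Proof.
move=> rho0 hu.
have : exists K1, 0 <= K1 /\ forall n, (n < n0)%N -> u n <= K1 * rho ^+ n.
  elim: n0 {hu} => [|k [K1 [K10 IH]]]; first by exists 0.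
  exists (Num.max K1 (u k / rho ^+ k)); split; first by rewrite le_max K10.
  move=> n; rewrite ltnS leq_eqVlt => /orP[/eqP ->|/IH h].
    by rewrite -ler_pdivrMr ?exprn_gt0 // le_max lexx orbT.
  by rewrite (le_trans h) // ler_wpM2r ?exprn_ge0 ?(ltW rho0) // le_max lexx.
case=> K1 [K10 h1]; exists (Num.max K1 (K / rho ^+ n0)) => n.
have [nn0|nn0] := ltnP n n0.
  by rewrite (le_trans (h1 n nn0)) // ler_wpM2r ?exprn_ge0 ?(ltW rho0) // le_max lexx.
rewrite -(subnKC nn0) (le_trans (hu _)) // exprD mulrA ler_wpM2r ?exprn_ge0 ?(ltW rho0) //.
by rewrite -ler_pdivrMr ?exprn_gt0 // le_max lexx orbT.
Qed.

(* The limiting recurrence factors through [y (n+1) - y n / z], which it multiplies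
   by z: a weighted sum of the norms of that difference and of [y n] is
   eventually contracted by 1 / rho. *)
Lemma recurrence_growth (alpha gamma y : nat -> C) (z : C) (rho : R) : z != 0 ->
  (forall n, y n.+2 = alpha n * y n.+1 - gamma n * y n) ->
  (alpha n : C^o) @[n --> \oo] --> (z + z^-1 : C^o) ->
  (gamma n : C^o) @[n --> \oo] --> (1 : C^o) ->
  normc z < rho -> normc z^-1 < rho ->
  exists K : R, forall n, normc (y n) <= K * rho ^+ n.
Proof.
move=> z0 hy ha hg hz hzV.
pose M := Num.max (normc z) (normc z^-1).
have M0 : 0 <= M by rewrite le_max normc_ge0.
have zM : normc z <= M by rewrite le_max lexx.
have zVM : normc z^-1 <= M by rewrite le_max lexx orbT.
pose d := rho - M.
have d0 : 0 < d by rewrite subr_gt0 gt_max hz hzV.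
have rho0 : 0 < rho by rewrite /d in d0; lra.
(* For the functional [S] below, one step costs M S, plus d |D| from the coupling, plus 2 eta (M +
   1) |y| + 2 eta |D| from the perturbation. The two bounds on [eta] keep the extra terms below d S,
   and M + d = rho. *)
pose eta := Num.min (d / 2) (d ^+ 2 / (2 * (M + 1))).
have eta0 : 0 < eta.
  by rewrite lt_min !divr_gt0 ?exprn_gt0 ?mulr_gt0 //; lra.
have eta1 : eta <= d / 2 by rewrite ge_min lexx.
have eta2 : eta * (M + 1) <= d ^+ 2 / 2.
  have : eta <= d ^+ 2 / (2 * (M + 1)) by rewrite ge_min lexx orbT.
  rewrite ler_pdivlMr; last by rewrite mulr_gt0 //; lra.
  lra.
have [n0 [hn0 hn1]] : exists n0, (forall n, normc (alpha (n0 + n)%N - (z + z^-1)) <= eta)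
    /\ (forall n, normc (gamma (n0 + n)%N - 1) <= eta).
  have /cvgCP/cvgrPdist_lt/(_ _ eta0)[N1 _ h1] := ha.
  have /cvgCP/cvgrPdist_lt/(_ _ eta0)[N2 _ h2] := hg.
  exists (N1 + N2)%N; split => n.
    have := h1 (N1 + N2 + n)%N; rewrite /= -addnA leq_addr => /(_ isT).
    by rewrite sub0r normrN ger0_norm ?normc_ge0 // => /ltW.
  have := h2 (N1 + N2 + n)%N; rewrite /= addnAC leq_addl => /(_ isT).
  by rewrite sub0r normrN ger0_norm ?normc_ge0 // => /ltW.
pose D n := y n.+1 - z^-1 * y n.
pose S n := normc (y n) * d + 2 * normc (D n).
have step n : S (n0 + n).+1 <= rho * S (n0 + n)%N.
  have := hn0 n; have := hn1 n; move: (n0 + n)%N => k.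
  set eps := alpha k - _; set eps' := gamma k - 1 => he' he.
  have yS : y k.+1 = z^-1 * y k + D k by rewrite /D; ring.
  have DS : D k.+1 = z * D k + (eps * y k.+1 - eps' * y k).
    by rewrite /D hy /eps /eps'; field.
  have y0 := normc_ge0 (y k); have D0 := normc_ge0 (D k).
  have h1 : normc (y k.+1) <= M * normc (y k) + normc (D k).
    by rewrite yS (le_trans (le_normcD _ _)) // lerD2r normcM ler_wpM2r.
  have h2 : normc (D k.+1) <= M * normc (D k) + (eta * (M * normc (y k) + normc (D k))
      + eta * normc (y k)).
    rewrite DS (le_trans (le_normcD _ _)) // lerD //; first by rewrite normcM ler_wpM2r.
    rewrite (le_trans (le_normcD _ _)) // normcN !normcM lerD //.
      by rewrite ler_pM ?normc_ge0.
    by rewrite ler_wpM2r.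
  have h3 : eta * (M + 1) * normc (y k) <= d ^+ 2 / 2 * normc (y k) by rewrite ler_wpM2r.
  have h4 : eta * normc (D k) <= d / 2 * normc (D k) by rewrite ler_wpM2r.
  have h5 : normc (y k.+1) * d <= (M * normc (y k) + normc (D k)) * d.
    by rewrite ler_wpM2r // ltW.
  rewrite /S (_ : rho = M + d); last by rewrite /d; ring.
  lra.
have hS n : S (n0 + n)%N <= S n0 * rho ^+ n.
  elim: n => [|n IH]; first by rewrite addn0 mulr1.
  by rewrite addnS (le_trans (step n)) // exprS mulrCA ler_wpM2l // (ltW rho0).
apply: (@geometric_bound (fun n => normc (y n)) (S n0 / d) rho n0 rho0) => n.
rewrite mulrAC ler_pdivlMr // (le_trans _ (hS n)) // lerDl.
by rewrite mulr_ge0 // normc_ge0.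
Qed.
End Growth.

(** * The expansion of 1 *)

Section Expansion.
Local Open Scope classical_set_scope.
Variable R : realType.
Local Notation C := R[i].
Variables q z a b e f : C.
Hypothesis hq : 0 < `|q| < 1.
Hypotheses (z0 : z != 0) (a0 : a != 0).
Hypotheses (hab : qregular q (a * b)) (hae : qregular q (a * e)) (haf : qregular q (a * f)).
Hypotheses (hbe : qregular q (b * e)) (hef : qregular q (e * f)).
Local Notation A := (aw_par q a b e f).
Local Notation phi := (aw_phi q z a b e f).
Local Notation up := (aw_up q a b e f).
Local Notation down := (aw_down q a b e f).
Hypothesis hA : qregular q A.

Let q0 : q != 0.
Proof. by rewrite -normr_gt0; case/andP: hq. Qed.

(* c^k (e/c;q)_k, in a form that makes sense for c = 0. *)
Definition shifted_pow (c : C) k := \prod_(l < k) (c - e * q ^+ l).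

(** The coefficient of phi_k in the first formula at n = 0: (abef;q)_{2k} / (abef/q;q)_{2k} is (1 -
    A q^(2k))/(1 - A), and (ae;q)_k cancels against the normalization of p_k; see
    [weight_askey_wilson]. *)
Definition weight (c : C) k :=
  shifted_pow c k * (1 - A * q ^+ (2 * k)) / (1 - A)
  * (qpoch A q k * qpoch (a * b) q k * qpoch (a * f) q k)
  / (a ^+ k * (qpoch q q k * qpoch (b * e) q k * qpoch (e * f) q k
               * qpoch (a * b * c * f) q k)).

Lemma one_sub_A : 1 - A != 0.
Proof. by have := subr1_regular hq 0 hA; rewrite mulr1. Qed.

(* The difference collapses to a single product, so that the q-shift c -> cq of the
   weights becomes a telescoping identity. *)
Lemma weight_flux c k : qregular q (a * b * c * f) ->
  down k.+1 * weight c k.+1 - up k * weight c k =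
  - (1 - a * c) / a * (shifted_pow c k
    * (qpoch A q k.+1 * qpoch (a * b) q k.+1 * qpoch (a * f) q k.+1)
    / (a ^+ k * ((1 - A) * (qpoch q q k * qpoch (b * e) q k * qpoch (e * f) q k)
       * qpoch (a * b * c * f) q k.+1))).
Proof.
move=> hc; rewrite /weight /shifted_pow big_ord_recr /=.
have qk := qpochqq_neq0 hq k.+1; have bek := qpoch_neq0 k.+1 q0 hbe.
have efk := qpoch_neq0 k.+1 q0 hef; have abcfk := qpoch_neq0 k.+1 q0 hc.
move: qk bek efk abcfk; rewrite !(qpochSr _ q k) !mulf_eq0 !negb_or.
move=> /andP[qk qk1] /andP[bek bek1] /andP[efk efk1] /andP[abcfk abcfk1].
rewrite /aw_down /aw_up.
have := subr1_regular hq (2 * k) hA; have := subr1_regular hq (2 * k).+1 hA.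
have := subr1_regular hq (2 * k).+2 hA; have := one_sub_A.
have := expf_neq0 k a0.
have -> : (2 * k.+1 = (k + k).+2)%N by rewrite mul2n doubleS addnn.
have -> : (2 * k = k + k)%N by rewrite mul2n addnn.
rewrite !exprS !exprD.
move: qk bek efk abcfk qk1 bek1 efk1 abcfk1.
move: (qpoch q q k) (qpoch (b * e) q k) (qpoch (e * f) q k) (qpoch (a * b * c * f) q k).
move: (qpoch A q k) (qpoch (a * b) q k) (qpoch (a * f) q k)
  (\prod_(i < k) _) (q ^+ k) (a ^+ k).
move=> t1 t2 t3 t4 s ak d1 d2 d3 d4 D1 D2 D3 D4 E1 E2 E3 E4 F1 F2.
rewrite /aw_par => F3 F4 F5.
have G1 : q - a * b * e * f != 0.
  have -> : q - a * b * e * f = q * (1 - a * b * e * f / q) by field.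
  by rewrite mulf_neq0.
have G2 : 1 - a * b * e * f * (s * s) != 0.
  have -> : 1 - a * b * e * f * (s * s) = 1 - a * b * e * f / q * (q * (s * s)) by field.
  by [].
have G3 : 1 - a * b * e * f * (q * (s * s)) != 0.
  have -> : 1 - a * b * e * f * (q * (s * s)) =
      1 - a * b * e * f / q * (q * (q * (s * s))) by field.
  by [].
have G4 : q - a * b * e * f * (s * s) != 0.
  have -> : q - a * b * e * f * (s * s) = q * (1 - a * b * e * f / q * (s * s)) by field.
  by rewrite mulf_neq0.
field.
by rewrite q0 E4 D1 D2 D3 D4 G1 F1 a0 G2 G4 E3 E2 E1 G3.
Qed.

Lemma shifted_powM c k : shifted_pow (c * q) k.+1 = (c * q - e) * q ^+ k * shifted_pow c k.
Proof.
rewrite /shifted_pow big_ord_recl expr0 mulr1 -mulrA; congr (_ * _).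
elim: k => [|k IH]; first by rewrite !big_ord0 mulr1.
by rewrite !big_ord_recr IH /= /bump /= add1n !exprS; ring.
Qed.

Definition flux c k := down k.+1 * weight c k.+1 - up k * weight c k.

Lemma weight_shift0 c : qregular q (a * b * c * f) ->
  (1 - a * c) * (1 - c / a) * (1 - a * b * c * f) * weight c 0
    - c * (1 - a * b * c * f) * flux c 0
  = (1 - a * c) * (1 - b * c) * (1 - c * f) * weight (c * q) 0.
Proof.
move=> hc; rewrite /flux weight_flux // /weight /shifted_pow !big_ord0 !qpochSr !qpoch0 !expr0.
have := subr1_regular hq 0 hc; have := one_sub_A; rewrite !mulr1 => F1 F2.
by field; rewrite a0 F1 F2.
Qed.

(** This is the coefficient of phi_k in the relation between S(c) and S(cq), once (1 - cz)(1 - c/z)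
    is split as (1 - ac)(1 - c/a) minus c times the eigenvalue and the eigenvalue is traded for
    differences of [flux]. At k = 0 there is no preceding flux, whence [weight_shift0]. *)
Lemma weight_shift c k : qregular q (a * b * c * f) ->
  (1 - a * c) * (1 - c / a) * (1 - a * b * c * f) * weight c k.+1
    - c * (1 - a * b * c * f) * (flux c k.+1 - flux c k)
  = (1 - a * c) * (1 - b * c) * (1 - c * f) * weight (c * q) k.+1.
Proof.
move=> hc; rewrite /flux !weight_flux // /weight shifted_powM.
have -> : shifted_pow c k.+1 = shifted_pow c k * (c - e * q ^+ k).
  by rewrite /shifted_pow big_ord_recr.
have qk := qpochqq_neq0 hq k.+1; have bek := qpoch_neq0 k.+1 q0 hbe.
have efk := qpoch_neq0 k.+1 q0 hef; have abcfk := qpoch_neq0 k.+2 q0 hc.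
have c0 := subr1_regular hq 0 hc; rewrite expr0 mulr1 in c0.
have abcqf : qpoch (a * b * (c * q) * f) q k.+1 =
    qpoch (a * b * c * f) q k.+2 / (1 - a * b * c * f).
  apply: (mulIf c0); rewrite divfK // mulrC [RHS]qpochS.
  by congr (_ * qpoch _ q _); ring.
rewrite abcqf.
move: qk bek efk abcfk; rewrite !(qpochSr _ q k.+1) !(qpochSr _ q k) !mulf_eq0 !negb_or.
move=> /andP[qk qk1] /andP[bek bek1] /andP[efk efk1] /andP[/andP[abcfk abcfk1] abcfk2].
have := one_sub_A; have := expf_neq0 k a0.
have -> : (2 * k.+1 = (k + k).+2)%N by rewrite mul2n doubleS addnn.
move: qk1 bek1 efk1 abcfk1 abcfk2.
rewrite !exprS !exprD.
move: qk bek efk abcfk c0.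
move: (qpoch q q k) (qpoch (b * e) q k) (qpoch (e * f) q k) (qpoch (a * b * c * f) q k).
move: (qpoch A q k) (qpoch (a * b) q k) (qpoch (a * f) q k)
  (shifted_pow c k) (q ^+ k) (a ^+ k).
move=> t1 t2 t3 t4 s ak d1 d2 d3 d4 D1 D2 D3 D4 D5 E1 E2 E3 E4 E5 F1.
rewrite /aw_par => F3.
have G1 : q - a * b * e * f != 0.
  have -> : q - a * b * e * f = q * (1 - a * b * e * f / q) by field.
  by rewrite mulf_neq0.
field.
by rewrite D5 E5 E4 D4 E3 D3 E2 D2 E1 D1 F1 a0 q0 G1.
Qed.

Definition boundary c N :=
  c * (1 - a * b * c * f)
  * (down N.+1 * (weight c N.+1 * phi N) - up N * (weight c N * phi N.+1)).

(** Summation by parts moves the differences from phi_k to the weights, where [weight_shift] absorbs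
    them; [boundary] is what is left at the upper end. *)
Lemma partial_sum_shift c N : qregular q (a * b * c * f) ->
  (1 - c * z) * (1 - c * z^-1) * (1 - a * b * c * f) * (\sum_(k < N.+1) weight c k * phi k)
  - (1 - a * c) * (1 - b * c) * (1 - c * f) * (\sum_(k < N.+1) weight (c * q) k * phi k)
  = boundary c N.
Proof.
move=> hc; elim: N => [|N IH].
  rewrite !big_ord1 !(mulrA _ (weight _ _)) -weight_shift0 // /boundary /flux.
  have := aw_phi_rec hq z0 a0 hab hae haf hA 0.
  have -> : down 0 = 0 by rewrite /aw_down expr0 subrr mulr0 !mul0r.
  rewrite mul0r subr0 => rec.
  have -> : up 0 * (weight c 0 * phi 1) =
      weight c 0 * (up 0 * (phi 1 - phi 0)) + up 0 * weight c 0 * phi 0 by ring.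
  rewrite rec; field.
  by rewrite a0 z0.
rewrite !(big_ord_recr N.+1) /= !(mulrDr _ (\sum_(i < _) _)) opprD addrACA IH.
rewrite !(mulrA _ (weight _ N.+1)) -weight_shift // /boundary /flux.
have rec := aw_phi_rec hq z0 a0 hab hae haf hA N.+1.
have -> : up N.+1 * (weight c N.+1 * phi N.+2) =
      weight c N.+1 * (up N.+1 * (phi N.+2 - phi N.+1) - down N.+1 * (phi N.+1 - phi N.+1.-1))
      + up N.+1 * weight c N.+1 * phi N.+1
      + weight c N.+1 * down N.+1 * (phi N.+1 - phi N) by ring.
rewrite rec; field.
by rewrite a0 z0.
Qed.

(** * Asymptotics in k, and bounds uniform in the shift of c *)

Lemma cvg_qX : (q ^+ n : C^o) @[n --> \oo] --> (0 : C^o).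
Proof.
apply/cvgCP; have /andP[r0 r1] := normc_q hq.
have -> : (fun n => normc (q ^+ n - 0)) = geometric 1 (normc q).
  by apply/funext => n /=; rewrite subr0 normcX mul1r.
by apply: cvg_geometric; rewrite gtr0_norm.
Qed.

Lemma cvg_subr1 x (u : nat -> C) : (u n : C^o) @[n --> \oo] --> (0 : C^o) ->
  (1 - x * u n : C^o) @[n --> \oo] --> (1 : C^o).
Proof.
move=> hu; rewrite -[X in _ --> X](subr0 (1 : C)) -(mulr0 x).
by apply: cvgB; [exact: cvgCK|apply: cvgCMl].
Qed.

Lemma cvg_qX_double : (q ^+ (2 * n) : C^o) @[n --> \oo] --> (0 : C^o).
Proof.
apply: (cvgC_ext _ (mulr0 (0 : C)) (cvgCM cvg_qX cvg_qX)) => n /=.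
by rewrite mul2n -addnn exprD.
Qed.

Lemma cvg_aw_up : (up n : C^o) @[n --> \oo] --> (a^-1 : C^o).
Proof.
rewrite /aw_up; have -> : a^-1 = 1 * 1 * 1 * 1 / (a * 1 * 1) by rewrite !mulr1 mul1r.
apply: cvgCM.
  by apply: cvgCM; first (apply: cvgCM; first apply: cvgCM); apply: cvg_subr1; exact: cvg_qX.
apply: cvgCV; first by rewrite !mulr1.
apply: cvgCM; first apply: cvgCMl; apply: cvg_subr1; first exact: cvg_qX_double.
apply: (cvgC_ext _ (mulr0 q) (cvgCMl (x := q) cvg_qX_double)) => n /=.
by rewrite exprS.
Qed.

Lemma cvg_aw_down : (down n : C^o) @[n --> \oo] --> (a : C^o).
Proof.
apply: (@cvgC_ext _ down _ (a * 1 * 1 * 1 * 1 / (1 * 1))) => //.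
  by rewrite !mulr1 divr1.
rewrite /aw_down.
have h x : (1 - x * q ^+ n / q : C^o) @[n --> \oo] --> (1 : C^o).
  apply: (cvgC_ext _ erefl (cvg_subr1 (x / q) cvg_qX)) => n /=.
  by rewrite mulrAC.
have h1 : (1 - q ^+ n : C^o) @[n --> \oo] --> (1 : C^o).
  by apply: (cvgC_ext _ erefl (cvg_subr1 1 cvg_qX)) => n /=; rewrite mul1r.
apply: cvgCM.
  exact: cvgCM (cvgCM (cvgCM (cvgCMl h1) (h _)) (h _)) (h _).
apply: cvgCV; first by rewrite mulr1 oner_neq0.
apply: cvgCM; first by apply: cvg_subr1; exact: cvg_qX_double.
apply: (cvgC_ext _ erefl (cvg_subr1 (A / q) cvg_qX_double)) => n /=.
by rewrite mulrAC.
Qed.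

Lemma aw_up_neq0 n : up n != 0.
Proof.
by rewrite !(mulf_neq0, invr_neq0) ?(subr1_regular hq).
Qed.

(** Since [up] tends to 1/a and [down] to a, phi_n / a^n satisfies a recurrence whose limit is y'' =
    (z + 1/z) y' - y (primes denoting shifts of n), with roots z and 1/z. *)
Lemma aw_phi_growth (rho : R) : normc z < rho -> normc z^-1 < rho ->
  exists K : R, forall n, normc (phi n) <= K * (normc a * rho) ^+ n.
Proof.
move=> h1 h2; pose y n := phi n / a ^+ n.
pose alpha n := (1 + (down n.+1 + (z + z^-1 - a - a^-1)) / up n.+1) / a.
pose gamma n := down n.+1 / up n.+1 / a ^+ 2.
have upS : (up n.+1 : C^o) @[n --> \oo] --> (a^-1 : C^o).
  exact: (cvgC_shift 1 cvg_aw_up).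
have downS : (down n.+1 : C^o) @[n --> \oo] --> (a : C^o).
  exact: (cvgC_shift 1 cvg_aw_down).
have upV : ((up n.+1)^-1 : C^o) @[n --> \oo] --> (a : C^o).
  by apply: (cvgC_ext _ (invrK a) (cvgCV _ upS)); rewrite ?invr_eq0.
have [] := @recurrence_growth _ alpha gamma y z rho z0 _ _ _ h1 h2.
- move=> n; have := aw_phi_rec hq z0 a0 hab hae haf hA n.+1 => /= rec.
  have u0 := aw_up_neq0 n.+1; have an := expf_neq0 n a0.
  have -> : y n.+2 = (up n.+1 * (phi n.+2 - phi n.+1) + up n.+1 * phi n.+1)
      / up n.+1 / a ^+ n.+2.
    by rewrite /y !exprS; field; rewrite u0 a0 an.
  have -> : up n.+1 * (phi n.+2 - phi n.+1) = down n.+1 * (phi n.+1 - phi n)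
      + (z + z^-1 - a - a^-1) * phi n.+1 by rewrite -rec; ring.
  by rewrite /y /alpha /gamma !exprS; field; rewrite ?u0 ?a0 ?an ?z0.
- have <- : (1 + (a + (z + z^-1 - a - a^-1)) * a) / a = z + z^-1 by field; rewrite a0 z0.
  exact: cvgCM (cvgCD (@cvgCK _ 1) (cvgCM (cvgCD downS (@cvgCK _ _)) upV)) (@cvgCK _ _).
- have <- : a * a / a ^+ 2 = 1 by rewrite -expr2 divff // expf_neq0.
  exact: cvgCM (cvgCM downS upV) (@cvgCK _ _).
move=> K hK; exists K => n; have := hK n.
rewrite /y normcM normcV ler_pdivrMr; last exact: normc_gt0 (expf_neq0 n a0).
by rewrite normcX exprMn mulrAC mulrA.
Qed.
Local Hint Resolve normc_ge0 : core.

(** Each factor is at most t (1 + (|e|/t) |q|^l), and the product of the brackets is bounded. [K]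
    must not depend on [c], which will run through the shifts c q^m. *)
Lemma shifted_pow_bound (t : R) : 0 < t ->
  exists K : R, forall c k, normc c <= t -> normc (shifted_pow c k) <= K * t ^+ k.
Proof.
move=> t0; have /andP[r0 r1] := normc_q hq; set r := normc q in r0 r1.
pose s := normc e / t / (1 - r).
have s0 : 0 <= s by rewrite !divr_ge0 ?normc_ge0 ?(ltW t0) // subr_ge0 ltW.
exists (expR s) => c k ct.
suff h : normc (shifted_pow c k) <= expR (s * (1 - r ^+ k)) * t ^+ k.
  rewrite (le_trans h) // ler_wpM2r ?exprn_ge0 ?(ltW t0) // ler_expR.
  by rewrite ler_piMr // gerBl exprn_ge0 // ltW.
elim: k => [|k IH]; first by rewrite /shifted_pow big_ord0 normc1 !expr0 subrr mulr0 expR0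
  mulr1.
rewrite /shifted_pow big_ord_recr normcM -/(shifted_pow c k).
have -> : s * (1 - r ^+ k.+1) = s * (1 - r ^+ k) + normc e / t * r ^+ k.
  by rewrite /s exprS; field; rewrite !gt_eqF ?subr_gt0.
rewrite expRD exprSr mulrACA ler_pM ?normc_ge0 //.
apply: le_trans (le_normcD _ _) _; rewrite normcN normcM normcX -/r.
have h := expR_ge1Dx (normc e / t * r ^+ k).
have -> : normc e * r ^+ k = normc e / t * r ^+ k * t by field; rewrite gt_eqF.
have := ler_wpM2r (ltW t0) h; lra.
Qed.

(** The inverse is the ratio (x;q)_m / (x;q)_{m+k}, bounded above by [qpoch_le_expR] and
    [qpoch_lower]. *)
Lemma qpochV_bound x : qregular q x ->
  exists K : R, forall m k, normc (qpoch (x * q ^+ m) q k)^-1 <= K.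
Proof.
move=> hx; have [d d0 hd] := qpoch_lower hq hx.
exists (expR (normc x / (1 - normc q)) / d) => m k.
have dm : 0 < normc (qpoch x q m) by rewrite (lt_le_trans d0).
have dk : 0 < normc (qpoch x q (m + k)) by rewrite (lt_le_trans d0).
have -> : (qpoch (x * q ^+ m) q k)^-1 = qpoch x q m / qpoch x q (m + k).
  by rewrite qpochD invfM mulVKf // qpoch_neq0.
rewrite normcM normcV ler_pM ?normc_ge0 ?invr_ge0 ?normc_ge0 ?qpoch_le_expR //.
by rewrite lef_pV2.
Qed.

Lemma weight_bound (c : C) (t : R) : 0 < t -> normc c <= t -> qregular q (a * b * c * f) ->
  exists K : R, forall m k, normc (weight (c * q ^+ m) k) <= K * (t / normc a) ^+ k.
Proof.
move=> t0 ct hc.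
have [K1 h1] := shifted_pow_bound t0; have [K2 h2] := qpochV_bound hc.
have [K3 h3] := qpochV_bound (qregular_lt1 hq (proj2 (andP hq))).
have [K4 h4] := qpochV_bound hbe; have [K5 h5] := qpochV_bound hef.
pose N := normc A; pose B x := expR (normc x / (1 - normc q)).
have hb x k : normc (qpoch x q k) <= B x by exact: qpoch_le_expR.
exists (K1 * ((1 + N) * normc (1 - A)^-1 * (B A * B (a * b) * B (a * f))
   * (K3 * K4 * K5 * K2))) => m k.
have /andP[r0 r1] := normc_q hq.
have cm : normc (c * q ^+ m) <= t.
  rewrite normcM normcX (le_trans _ ct) // ler_piMr ?normc_ge0 //.
  by rewrite exprn_ile1 // ltW.
(* The trivial [q ^+ 0] lets [qpochV_bound] serve the fixed and the shifted factors alike. *)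
pose X := (1 - A * q ^+ (2 * k)) * (1 - A)^-1
    * (qpoch A q k * qpoch (a * b) q k * qpoch (a * f) q k)
    * ((qpoch (q * q ^+ 0) q k)^-1 * (qpoch (b * e * q ^+ 0) q k)^-1
       * (qpoch (e * f * q ^+ 0) q k)^-1 * (qpoch (a * b * c * f * q ^+ m) q k)^-1).
have -> : weight (c * q ^+ m) k = shifted_pow (c * q ^+ m) k * (a ^+ k)^-1 * X.
  rewrite /weight /X !mulr1 !invfM.
  have -> : a * b * (c * q ^+ m) * f = a * b * c * f * q ^+ m by ring.
  by ring.
have hX : normc X <= (1 + N) * normc (1 - A)^-1 * (B A * B (a * b) * B (a * f))
    * (K3 * K4 * K5 * K2).
  rewrite /X !normcM.
  have hA1 : normc (1 - A * q ^+ (2 * k)) <= 1 + N.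
    rewrite (le_trans (le_normcD _ _)) // normc1 normcN normcM normcX lerD2l.
    by rewrite ler_piMr ?normc_ge0 // exprn_ile1 // ltW.
  apply: ler_pM; rewrite ?mulr_ge0 ?mulr_ge0 //.
    apply: ler_pM; rewrite ?mulr_ge0 ?mulr_ge0 //; first by rewrite ler_wpM2r.
    by apply: ler_pM; rewrite ?mulr_ge0 ?hb //; apply: ler_pM; rewrite ?hb.
  apply: ler_pM; rewrite ?mulr_ge0 ?mulr_ge0 ?h2 //.
  apply: ler_pM; rewrite ?mulr_ge0 ?h5 //.
  by apply: ler_pM; rewrite ?h3 ?h4.
rewrite normcM [X in _ <= X]mulrAC ler_pM ?normc_ge0 //.
rewrite normcM normcV normcX expr_div_n mulrA ler_wpM2r ?h1 //.
by rewrite invr_ge0 exprn_ge0 ?normc_ge0.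
Qed.

(** The powers of |a| in the two bounds cancel. The result is the majorant, independent of [m], that
    [tannery] asks for. *)
Lemma weight_phi_bound c (t rho : R) : 0 < t -> normc c <= t -> qregular q (a * b * c * f) ->
  normc z < rho -> normc z^-1 < rho ->
  exists K : R, forall m k, normc (weight (c * q ^+ m) k * phi k) <= K * (t * rho) ^+ k.
Proof.
move=> t0 ct hc h1 h2.
have [K1 hK1] := weight_bound t0 ct hc.
have [K2 hK2] := aw_phi_growth h1 h2.
exists (K1 * K2) => m k.
have na : normc a != 0 by rewrite gt_eqF ?normc_gt0.
have -> : K1 * K2 * (t * rho) ^+ k = (K1 * (t / normc a) ^+ k) * (K2 * (normc a * rho) ^+ k).
  by rewrite mulrACA -exprMn; congr (_ * _ ^+ _); field.
by rewrite normcM ler_pM ?normc_ge0.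
Qed.

Lemma cvg_shifted_pow c k :
  (shifted_pow (c * q ^+ m) k : C^o) @[m --> \oo] --> (shifted_pow 0 k : C^o).
Proof.
elim: k => [|k IH].
  by apply: cvgC_const => m; rewrite /shifted_pow !big_ord0.
have h : (c * q ^+ m - e * q ^+ k : C^o) @[m --> \oo] --> (c * 0 - e * q ^+ k : C^o).
  exact: cvgCD (cvgCMl cvg_qX) (@cvgCK _ _).
apply: (cvgC_ext _ _ (cvgCM IH h)) => [m|]; rewrite /shifted_pow big_ord_recr //=.
by rewrite mulr0.
Qed.

Lemma cvg_weight c k :
  (weight (c * q ^+ m) k : C^o) @[m --> \oo] --> (weight 0 k : C^o).
Proof.
rewrite /weight.
have h : (qpoch (a * b * (c * q ^+ m) * f) q k : C^o) @[m --> \oo]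
    --> (qpoch (a * b * 0 * f) q k : C^o).
  rewrite mulr0 mul0r; elim: k => [|k IH].
    by apply: cvgC_const => m; rewrite !qpoch0.
  rewrite qpochSr mul0r subr0.
  apply: (cvgC_ext _ erefl (cvgCM IH (cvg_subr1 (a * b * c * f * q ^+ k) cvg_qX))) => m.
  by rewrite qpochSr; congr (_ * (1 - _)); ring.
have q00 : qpoch (a * b * 0 * f) q k != 0.
  rewrite mulr0 mul0r; apply/prodf_neq0 => i _.
  by rewrite mul0r subr0 oner_neq0.
apply: cvgCM.
  apply: cvgCM; last exact: cvgCK.
  apply: cvgCM; last exact: cvgCK.
  apply: cvgCM; last exact: cvgCK.
  exact: cvg_shifted_pow.
apply: cvgCV; last exact: cvgCMl (cvgCMl h).
by rewrite !mulf_neq0 ?q00 ?expf_neq0 ?qpochqq_neq0 ?qpoch_neq0.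
Qed.

(** All that iterating the shift requires. It is verified in two unrelated ways: by geometric decay
    when |cz| and |c/z| are below 1, and by termination at [e]. *)
Definition admissible c := (forall m, csummable (fun k => weight (c * q ^+ m) k * phi k))
  /\ (forall m, (boundary (c * q ^+ m) N : C^o) @[N --> \oo] --> (0 : C^o)).

Lemma abcfX c m : qregular q (a * b * c * f) -> qregular q (a * b * (c * q ^+ m) * f).
Proof.
move=> hc; have -> : a * b * (c * q ^+ m) * f = a * b * c * f * q ^+ m by ring.
exact: qregularM.
Qed.

Lemma series_ord (u : nat -> C) N : series u N = \sum_(k < N) u k.
Proof. by rewrite /series /= big_mkord. Qed.

Lemma csum_shift c : qregular q (a * b * c * f) -> admissible c ->
  (1 - c * z) * (1 - c * z^-1) * (1 - a * b * c * f) * csum (fun k => weight c k * phi k)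
  = (1 - a * c) * (1 - b * c) * (1 - c * f) * csum (fun k => weight (c * q) k * phi k).
Proof.
move=> hc [hs hb].
have hs0 := csum_cvg (hs 0); have hs1 := csum_cvg (hs 1); have hb0 := hb 0.
rewrite expr0 mulr1 in hs0 hb0; rewrite expr1 in hs1.
pose K1 := (1 - c * z) * (1 - c * z^-1) * (1 - a * b * c * f).
pose K2 := (1 - a * c) * (1 - b * c) * (1 - c * f).
rewrite -/K1 -/K2.
pose u k := weight c k * phi k; pose v k := weight (c * q) k * phi k.
have lim : (K1 * series u (1 + N)%N + - K2 * series v (1 + N)%N : C^o) @[N --> \oo]
    --> (K1 * csum u + - K2 * csum v : C^o).
  exact: cvgCD (cvgCMl (cvgC_shift 1 hs0)) (cvgCMl (cvgC_shift 1 hs1)).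
have E N : boundary c N = K1 * series u (1 + N)%N + - K2 * series v (1 + N)%N.
  rewrite !series_ord add1n mulNr.
  by rewrite -(partial_sum_shift N hc).
have := cvgC_unique (cvgC_ext E erefl hb0) lim.
by move/esym/eqP; rewrite mulNr subr_eq0 => /eqP.
Qed.

Lemma csum_shiftn c m : qregular q (a * b * c * f) -> admissible c ->
  qpoch (c * z) q m * qpoch (c * z^-1) q m * qpoch (a * b * c * f) q m
    * csum (fun k => weight c k * phi k)
  = qpoch (a * c) q m * qpoch (b * c) q m * qpoch (c * f) q m
    * csum (fun k => weight (c * q ^+ m) k * phi k).
Proof.
move=> hc [hs hb]; elim: m => [|m IH]; first by rewrite !qpoch0 expr0 !mulr1.
have hg : admissible (c * q ^+ m).
  split=> j; [have := hs (m + j)%N|have := hb (m + j)%N]; by rewrite exprD mulrA.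
have := csum_shift (abcfX m hc) hg.
have -> : c * q ^+ m * q = c * q ^+ m.+1 by rewrite exprSr mulrA.
move=> h.
rewrite !qpochSr.
transitivity ((1 - c * q ^+ m * z) * (1 - c * q ^+ m / z) * (1 - a * b * (c * q ^+ m) * f) *
  (qpoch (c * z) q m * qpoch (c * z^-1) q m * qpoch (a * b * c * f) q m
    * csum (fun k => weight c k * phi k))).
  by ring.
rewrite IH mulrCA h; ring.
Qed.

Lemma admissible_small c (rho : R) : 0 < rho -> normc c * rho < 1 -> c != 0 ->
  qregular q (a * b * c * f) -> normc z < rho -> normc z^-1 < rho -> admissible c.
Proof.
move=> rho0 crho c0 hc h1 h2.
have t0 := normc_gt0 c0.
have s01 : 0 <= normc c * rho < 1 by rewrite crho mulr_ge0 ?(ltW t0) ?(ltW rho0).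
split=> m.
  have [K hK] := weight_phi_bound t0 (lexx _) hc h1 h2.
  by apply: csummable_geometric s01 _ => k; exact: hK.
have [K1 hK1] := weight_bound t0 (lexx _) hc.
have [K2 hK2] := aw_phi_growth h1 h2.
have a1 := normc_gt0 a0.
set d := c * q ^+ m.
have geo (K : R) (u : nat -> C) : (forall N, normc (u N) <= K * (normc c * rho) ^+ N) ->
    (u N : C^o) @[N --> \oo] --> (0 : C^o).
  move=> hu; apply/cvgCP.
  have hg : geometric K (normc c * rho) @ \oo --> (0 : R).
    by apply: cvg_geometric; rewrite ger0_norm; case/andP: s01.
  apply: (squeeze_cvgr _ (@cvg_cst _ 0 _ _ _) hg); apply: nearW => N.
  by rewrite subr0 normc_ge0 hu.
have lim1 : (weight d N.+1 * phi N : C^o) @[N --> \oo] --> (0 : C^o).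
  apply: (geo (K1 * K2 * (normc c / normc a))) => N.
  have -> : K1 * K2 * (normc c / normc a) * (normc c * rho) ^+ N =
      (K1 * (normc c / normc a) ^+ N.+1) * (K2 * (normc a * rho) ^+ N).
    have -> : normc c * rho = normc c / normc a * (normc a * rho) by field; rewrite gt_eqF.
    by rewrite exprMn exprS; ring.
  by rewrite normcM ler_pM ?hK1.
have lim2 : (weight d N * phi N.+1 : C^o) @[N --> \oo] --> (0 : C^o).
  apply: (geo (K1 * K2 * (normc a * rho))) => N.
  have -> : K1 * K2 * (normc a * rho) * (normc c * rho) ^+ N =
      (K1 * (normc c / normc a) ^+ N) * (K2 * (normc a * rho) ^+ N.+1).
    have -> : normc c * rho = normc c / normc a * (normc a * rho) by field; rewrite gt_eqF.
    by rewrite exprMn exprS; ring.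
  by rewrite normcM ler_pM ?hK1.
have lim := cvgCD (cvgCM (cvgC_shift 1 (cvg_aw_down)) lim1)
  (cvgCMl (x := -1) (cvgCM (cvg_aw_up) lim2)).
have := cvgCMl (x := d * (1 - a * b * d * f)) lim.
rewrite !mulr0 addr0 mulr0.
by apply: cvgC_ext => // N; rewrite mulN1r.
Qed.

Lemma weight_terminating m k : (m < k)%N -> weight (e * q ^+ m) k = 0.
Proof.
move=> mk; rewrite /weight /shifted_pow (bigD1 (Ordinal mk)) //= subrr.
by rewrite !mul0r.
Qed.

Lemma admissible_e : admissible e.
Proof.
split=> m.
  apply: (proj1 (@csum_terminating _ _ m _)) => k mk.
  by rewrite weight_terminating ?mul0r.
apply: cvg_near_cst; near=> N.
have mN : (m < N)%N by near: N; exact: nbhs_infty_gt.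
by rewrite /boundary !weight_terminating ?(ltnW mN) // 1?ltnW // !mul0r !mulr0 subrr mulr0.
Unshelve. all: by end_near. Qed.

Lemma csum_e : csum (fun k => weight e k * phi k) = 1.
Proof.
rewrite (proj2 (@csum_terminating _ _ 0 _)) => [|k k0].
  rewrite big_ord1 /weight /shifted_pow big_ord0 !qpoch0 !expr0 !mulr1.
  rewrite /aw_phi /tphi43 big_ord1 !qpoch0 expr0.
  by field; exact: one_sub_A.
by rewrite -[e]mulr1 -(expr0 q) weight_terminating ?mul0r.
Qed.

Lemma growth_rate c : c != 0 -> normc (c * z) < 1 -> normc (c * z^-1) < 1 ->
  exists rho : R, [/\ 0 < rho, normc c * rho < 1, normc z < rho & normc z^-1 < rho].
Proof.
move=> c0 cz cz'.
have t0 := normc_gt0 c0.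
pose M := Num.max (normc z) (normc z^-1).
have M0 : 0 <= M by rewrite le_max normc_ge0.
have cM : normc c * M < 1.
  by rewrite /M maxr_pMr ?normc_ge0 // gt_max -!normcM cz cz'.
have hM : M < (normc c)^-1 by rewrite -[_^-1]mul1r ltr_pdivlMr // mulrC.
(* The midpoint of the interval from M to 1/|c|, which is nonempty by [hM]. *)
exists ((M + (normc c)^-1) / 2).
have hz : normc z <= M by rewrite le_max lexx.
have hz' : normc z^-1 <= M by rewrite le_max lexx orbT.
split; [lra| |lra|lra].
rewrite mulrC -ltr_pdivlMr // mul1r; lra.
Qed.

Lemma admissible_disc c : c != 0 -> normc (c * z) < 1 -> normc (c * z^-1) < 1 ->
  qregular q (a * b * c * f) -> admissible c.
Proof.
move=> c0 cz cz' hc; have [rho [rho0 crho h1 h2]] := growth_rate c0 cz cz'.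
exact: admissible_small rho0 crho c0 hc h1 h2.
Qed.

(** The limit relations at [c] and at [e] both contain S(0). Cross-multiplying them eliminates it
    without a division, hence the form of the conclusion. *)
Lemma one_expansion c : e != 0 -> c != 0 -> normc (c * z) < 1 -> normc (c * z^-1) < 1 ->
  qregular q (a * b * c * f) -> qregular q (a * b * e * f) ->
  csummable (fun k => weight c k * phi k) /\
  qpochs_inf [:: a * e; b * e; e * f; a * b * c * f; c * z; c * z^-1] q
    * csum (fun k => weight c k * phi k)
  = qpochs_inf [:: a * c; b * c; c * f; a * b * e * f; e * z; e * z^-1] q.
Proof.
move=> e0 c0 cz cz' hc he.
have t0 := normc_gt0 c0.
have [rho [rho0 crho h1 h2]] := growth_rate c0 cz cz'.
have gc := admissible_disc c0 cz cz' hc.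
have s01 : 0 <= normc c * rho < 1 by rewrite crho mulr_ge0 ?(ltW t0) ?(ltW rho0).
split; first by have := proj1 gc 0; rewrite expr0 mulr1.
pose S d := csum (fun k => weight d k * phi k).
have lim d : normc d <= normc c -> qregular q (a * b * d * f) ->
    (S (d * q ^+ m) : C^o) @[m --> \oo] --> (S 0 : C^o).
  move=> dc hd; have [K hK] := weight_phi_bound t0 dc hd h1 h2.
  apply: (@tannery _ (fun m k => weight (d * q ^+ m) k * phi k) _ K _ s01 hK) => k.
  by apply: cvgCM; [exact: cvg_weight|exact: cvgCK].
have limc := lim c (lexx _) hc.
have lime : (S (e * q ^+ m) : C^o) @[m --> \oo] --> (S 0 : C^o).
  (* The majorant is available only for arguments of norm at most |c|; [e] is moved there by
     finitely many shifts, which do not change the limit. *)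
  have [m0 hm0] : exists m0, normc (e * q ^+ m0) <= normc c.
    have /cvgCP/cvgrPdist_lt/(_ _ t0)[N _ hN] := cvgCMl (x := e) cvg_qX.
    exists N; have := hN N (leqnn N).
    by rewrite /= mulr0 subr0 sub0r normrN ger0_norm ?normc_ge0 // => /ltW.
  have := lim _ hm0 (abcfX m0 he).
  have E m : S (e * q ^+ m0 * q ^+ m) = S (e * q ^+ (m + m0)).
    by rewrite addnC exprD mulrA.
  move=> /(cvgC_ext E erefl).
  by rewrite (cvg_shiftn m0 (fun m => S (e * q ^+ m) : C^o)).
have L d : qregular q (a * b * d * f) -> admissible d ->
    (S (d * q ^+ m) : C^o) @[m --> \oo] --> (S 0 : C^o) ->
    qpoch_inf (d * z) q * qpoch_inf (d * z^-1) q * qpoch_inf (a * b * d * f) q * S d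
    = qpoch_inf (a * d) q * qpoch_inf (b * d) q * qpoch_inf (d * f) q * S 0.
  move=> hd gd limd; have P x := @cvg_qpoch _ q hq x.
  have lhs := cvgCM (cvgCM (cvgCM (P (d * z)) (P (d * z^-1))) (P (a * b * d * f)))
    (@cvgCK _ (S d)).
  have rhs := cvgCM (cvgCM (cvgCM (P (a * d)) (P (b * d))) (P (d * f))) limd.
  exact: cvgC_unique (cvgC_ext (fun m => csum_shiftn m hd gd) erefl lhs) rhs.
have Lc := L c hc gc limc; have Le := L e he admissible_e lime.
have Se : S e = 1 by exact: csum_e.
rewrite Se mulr1 in Le.
rewrite /qpochs_inf !big_cons !big_nil -/(S c).
transitivity (qpoch_inf (a * e) q * qpoch_inf (b * e) q * qpoch_inf (e * f) q
  * (qpoch_inf (c * z) q * qpoch_inf (c / z) q * qpoch_inf (a * b * c * f) q * S c)).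
  by ring.
rewrite Lc mulrCA -Le; ring.
Qed.
End Expansion.

(** * Both formulas *)

Section Connecting.
Local Open Scope classical_set_scope.
Variable R : realType.
Local Notation C := R[i].
Variable q : C.
Hypothesis hq : 0 < `|q| < 1.

Let q0 : q != 0.
Proof. by rewrite -normr_gt0; case/andP: hq. Qed.

Lemma exprzB (x : C) (m n : nat) : x != 0 -> x ^ (m%:Z - n%:Z) = x ^+ m / x ^+ n.
Proof. by move=> x0; rewrite expfzDr // -exprnN. Qed.

Lemma phi43E n A x y D E F :
  phi43 (q ^- n) A x y D E F q q = tphi43 q n A x y D E F.
Proof.
rewrite /phi43 (proj2 (@csum_terminating _ _ n _)) => [|k nk].
  by apply: eq_bigr => k _; rewrite /qpochs !big_cons big_nil !mulr1 !mulrA.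
by rewrite /qpochs big_cons qpoch_eq0 // !mul0r.
Qed.

Lemma tphi43Cxy n A x y D E F : tphi43 q n A x y D E F = tphi43 q n A y x D E F.
Proof. by apply: eq_bigr => i _; rewrite (mulrC (qpoch x q i)). Qed.

Lemma tphi43CDE n A x y D E F : tphi43 q n A x y D E F = tphi43 q n A x y E D F.
Proof. by apply: eq_bigr => i _; congr (_ / _ * _); ring. Qed.

Lemma askey_wilson_phi n x z a b c d : z != 0 -> x = (z + z^-1) / 2 ->
  askey_wilson n x a b c d q =
  a ^- n * (qpoch (a * b) q n * qpoch (a * c) q n * qpoch (a * d) q n)
  * aw_phi q z a b c d n.
Proof.
move=> z0 hx; rewrite (askey_wilsonE _ _ _ _ _ _ z0 hx) /askey_wilson_z phi43E.
rewrite /qpochs !big_cons big_nil !mulr1 !mulrA /aw_phi.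
congr (_ * tphi43 _ _ _ _ _ _ _ _).
by rewrite (exprzB n 1) // /aw_par; field.
Qed.

(** Sears' transformation with w = a/c, g = bc, h = cd and {u, v} = {cz, c/z}; its factor w^n turns
    a^-n into c^-n. *)
Lemma askey_wilson_swap n x z a b c d : z != 0 -> x = (z + z^-1) / 2 -> a != 0 -> c != 0 ->
  qregular q (a * b) -> qregular q (a * c) -> qregular q (a * d) ->
  qregular q (b * c) -> qregular q (c * d) ->
  askey_wilson n x a b c d q =
  c ^- n * (qpoch (a * c) q n * qpoch (b * c) q n * qpoch (c * d) q n)
  * tphi43 q n (a * b * c * d / q * q ^+ n) (c * z) (c * z^-1) (a * c) (b * c) (c * d).
Proof.
move=> z0 hx a0 c0 hab hac had hbc hcd; rewrite (askey_wilson_phi _ _ _ _ _ z0 hx).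
have := @sears _ q hq n (c * z^-1) (c * z) (a / c) (b * c) (c * d).
have -> : c * z^-1 * (c * z) * (a / c) = a * c by field; rewrite c0 z0.
have -> : a / c * (b * c) = a * b by field.
have -> : a / c * (c * d) = a * d by field.
have -> : c * z * (a / c) = a * z by field.
have -> : c * z^-1 * (a / c) = a * z^-1 by field; rewrite c0 z0.
have -> : a * b * (c * d) * q ^+ n / q = aw_par q a b c d * q ^+ n by rewrite /aw_par; field.
have -> : a * b * c * d / q * q ^+ n = aw_par q a b c d * q ^+ n by [].
rewrite !qpoch_neq0 // => /(_ isT isT isT isT isT) h.
rewrite /aw_phi tphi43CDE (tphi43Cxy _ _ (c * z)).
move: h; set P := tphi43 q n _ (a * z) _ _ _ _; set Q := tphi43 q n _ (c * z^-1) _ _ _ _ => h.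
transitivity (a ^- n * qpoch (a * c) q n * (qpoch (a * b) q n * qpoch (a * d) q n * P)).
  by ring.
by rewrite h expr_div_n; field; rewrite !expf_neq0.
Qed.

(** Reversing one product brings in (-x)^n q^(n(n-1)/2). For a pair the signs cancel and the power
    of q becomes (q^(n-1))^n, free of binomials. *)
Lemma qpoch_reverse2 x y n : x != 0 -> y != 0 ->
  (q ^+ n / q) ^+ n * (x * y) ^+ n
    * (qpoch (q / (x * q ^+ n)) q n * qpoch (q / (y * q ^+ n)) q n)
  = qpoch x q n * qpoch y q n.
Proof.
move=> x0 y0; elim: n => [|n IH]; first by rewrite !qpoch0 !expr0 !mulr1.
have shift t : t != 0 -> q / (t * q ^+ n.+1) * q = q / (t * q ^+ n).
  by move=> t0; rewrite exprS; field; rewrite t0 q0 expf_neq0.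
rewrite (qpochS (_ / (x * _))) (qpochS (_ / (y * _))) !shift //.
rewrite (qpochSr x) (qpochSr y) [RHS]mulrACA -IH.
have qn := expf_neq0 n q0.
have -> : (q ^+ n.+1 / q) ^+ n.+1 = (q ^+ n / q) ^+ n * q ^+ n * q ^+ n.
  have -> : q ^+ n.+1 / q = q ^+ n by rewrite exprSr mulfK.
  by rewrite exprSr; congr (_ * _); rewrite -exprMn divfK.
rewrite !exprS; field.
by rewrite x0 y0 qn q0.
Qed.

Lemma tphi43_rot n A x y D E F : tphi43 q n A x y D E F = tphi43 q n A x y F D E.
Proof. by apply: eq_bigr => i _; congr (_ / _ * _); ring. Qed.

Lemma tphi43CAx n A x y D E F : tphi43 q n A x y D E F = tphi43 q n x A y D E F.
Proof. by apply: eq_bigr => i _; congr (_ / _ * _); ring. Qed.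

(** With q^-n and q^-k both among the upper parameters, either may be taken as the terminating one;
    both sums extend by zeros to a common range. *)
Lemma tphi43_exchange n k A x D E F :
  tphi43 q n A x (q ^- k) D E F = tphi43 q k A x (q ^- n) F E D.
Proof.
rewrite (@tphi43_extend _ _ hq n (n + k).+1) ?ltnS ?leq_addr //.
rewrite (@tphi43_extend _ _ hq k (n + k).+1) ?ltnS ?leq_addl //.
by apply: eq_bigr => i _; congr (_ / _ * _); ring.
Qed.

(* Sears' transformation produces a series that terminates both at n and at k. *)
Lemma tphi43_double n k a b c d e f :
  a != 0 -> b != 0 -> c != 0 -> d != 0 -> e != 0 -> f != 0 ->
  qregular q (a * b) -> qregular q (c * d) -> qregular q (a * b * c * f) ->
  qregular q (q / q ^+ k * (c / e)) -> qregular q (q / q ^+ n * (f / d)) ->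
  qpoch (c * d) q n * qpoch (a * b * c * f * q ^+ k) q n
    * tphi43 q n (q ^+ n / q * a * b * c * d) (c * f) (q * c / e)
        (c * d) (q ^+ k * a * b * c * f) (q / q ^+ k * (c / e))
  = (c * f) ^+ n * (qpoch (a * b * q ^+ k) q n * qpoch (d / f) q n)
    * tphi43 q n (c * f) (q * q / (q ^+ k * q ^+ n * (a * b * d * e))) (q ^- k)
        (q / q ^+ k * (c / e)) (q / (a * b * q ^+ k * q ^+ n)) (q / q ^+ n * (f / d)).
Proof.
move=> a0 b0 c0 d0 e0 f0 hab hcd habcf hce hfd.
have qn := expf_neq0 n q0; have qk := expf_neq0 k q0.
have -> : q ^+ k * a * b * c * f = a * b * c * f * q ^+ k by ring.
(* Sears' transformation is used with cf in the role of the parameter it fixes and with v = q^-k;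
   then v w = q^(n-1) abcd determines [w], and the lower parameters determine [g] and [h]. *)
set u := q * q / _; set g := q / (a * b * _ * _); set h := q / q ^+ n * _.
pose w := q ^+ n / q * q ^+ k * a * b * c * d.
have hg : qpoch g q n != 0.
  apply/prodf_neq0 => i _; rewrite subr_eq0 eq_sym /g.
  have lt_in : (i < n)%N by [].
  apply: contra (hab (k + (n - i.+1))%N) => /eqP gE; apply/eqP.
  have qE : q ^+ n = q ^+ (n - i.+1) * q ^+ i * q by rewrite -mulrA -exprSr -exprD subnK.
  have qi := expf_neq0 i q0; have qni := expf_neq0 (n - i.+1) q0.
  rewrite exprD invfM -[a * b]mulr1 -gE qE.
  by field; rewrite a0 b0 qk qi qni q0.
have := @sears _ q hq n u (q ^- k) w g h.
have -> : u * q ^- k * w = q / q ^+ k * (c / e).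
  by rewrite /u /w; field; rewrite a0 b0 d0 e0 qn qk q0.
have wg : w * g = c * d by rewrite /w /g; field; rewrite a0 b0 qn qk q0.
have wh : w * h = a * b * c * f * q ^+ k by rewrite /w /h; field; rewrite d0 qn q0.
have -> : w * g * h * q ^+ n / q = c * f.
  by rewrite wg /h; field; rewrite d0 qn q0.
have -> : q ^- k * w = q ^+ n / q * a * b * c * d by rewrite /w; field; rewrite qk q0.
have -> : u * w = q * c / e by rewrite /u /w; field; rewrite a0 b0 d0 e0 qn qk q0.
rewrite wg wh => S.
rewrite tphi43_rot tphi43CAx S ?hg ?(qpoch_neq0 n q0 hce) ?(qpoch_neq0 n q0 hcd) //;
  last first.
- exact: qpoch_neq0 n q0 hfd.
- exact: qpoch_neq0 n q0 (qregularM k q0 habcf).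
congr (_ * _).
rewrite -(@qpoch_reverse2 (a * b * q ^+ k) (d / f)) ?mulf_neq0 ?invr_neq0 //.
have -> : q / (d / f * q ^+ n) = h by rewrite /h; field; rewrite d0 f0 qn.
rewrite -/g [RHS]mulrA; congr (_ * _); rewrite -!exprMn; congr (_ ^+ _).
by rewrite /w; field; rewrite f0 q0.
Qed.

(** * Expansion of p_n, and comparison of the two inner series *)

Section Connection.
Variables (n : nat) (x z a b c d e f : C).
Hypotheses (z0 : z != 0) (a0 : a != 0) (b0 : b != 0) (c0 : c != 0) (d0 : d != 0)
  (e0 : e != 0) (f0 : f != 0) (hx : x = (z + z^-1) / 2).
Hypotheses (cz : normc (c * z) < 1) (cz' : normc (c * z^-1) < 1).
Hypotheses (hac : qregular q (a * c)) (hbc : qregular q (b * c)) (hcf : qregular q (c * f))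
  (habef : qregular q (a * b * e * f)) (hez : qregular q (e * z))
  (hezV : qregular q (e * z^-1))
  (hA : qregular q (a * b * e * f / q)) (hab : qregular q (a * b)) (hae : qregular q (a * e))
  (hbe : qregular q (b * e)) (hef : qregular q (e * f)) (habcf : qregular q (a * b * c * f))
  (hcd : qregular q (c * d)) (hce : forall k : nat, qregular q (q / q ^+ k * (c / e)))
  (hfd : qregular q (q / q ^+ n * (f / d)))
  (had : qregular q (a * d)) (haf : qregular q (a * f)).

Local Notation phi := (aw_phi q z a b e f).
Local Notation weight := (weight q a b e f).
Local Notation S := (fun c => csum (fun k => weight c k * phi k)).

Lemma shifted_powE k : shifted_pow q e c k = c ^+ k * qpoch (e / c) q k.
Proof.
elim: k => [|k IH]; first by rewrite /shifted_pow big_ord0 qpoch0 mulr1.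
rewrite /shifted_pow big_ord_recr -/(shifted_pow q e c k) IH qpochSr exprS /=.
by field.
Qed.

(** The origin of the parameters qc/e and q^(1-k) c/e of the inner 4phi3: shifting c by q^j trades
    products of length k for products of length j. The case k = 0 stands apart because
    [shifted_powM] starts at [k.+1]. *)
Lemma shifted_powX j k :
  shifted_pow q e (c * q ^+ j) k * qpoch (q / q ^+ k * (c / e)) q j =
  shifted_pow q e c k * qpoch (q * c / e) q j.
Proof.
case: k => [|k].
  by rewrite /shifted_pow !big_ord0 expr0 divr1 mulrA.
have qk := expf_neq0 k q0.
elim: j => [|j IH]; first by rewrite !qpoch0 expr0 !mulr1.
have -> : c * q ^+ j.+1 = c * q ^+ j * q by rewrite exprSr mulrA.
rewrite !qpochSr [RHS]mulrA -IH shifted_powM.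
rewrite [in RHS]/shifted_pow big_ord_recr -/(shifted_pow q e (c * q ^+ j) k) /=.
by rewrite exprS; field; rewrite e0 q0 qk.
Qed.

(** The left factor is what remains of the shift relation after (ac, bc; q)_j cancel against lower
    parameters in [askey_wilson_swap]; the right one supplies the k-dependent part of the j-th term
    of [Phi1]. *)
Lemma weightX j k :
  qpoch (c * f) q j / qpoch (a * b * c * f) q j * weight (c * q ^+ j) k =
  weight c k * (qpoch (c * f) q j * qpoch (q * c / e) q j
    / (qpoch (q ^+ k * a * b * c * f) q j * qpoch (q / q ^+ k * (c / e)) q j)).
Proof.
have R0 := qpoch_neq0 j q0 (hce k).
have -> : q ^+ k * a * b * c * f = a * b * c * f * q ^+ k by ring.
have P1 := qpoch_neq0 j q0 habcf; have P2 := qpoch_neq0 k q0 habcf.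
have P3 := qpoch_neq0 j q0 (qregularM k q0 habcf).
have A0 := one_sub_A hq hA.
rewrite /weight.
have -> : shifted_pow q e (c * q ^+ j) k =
    shifted_pow q e c k * qpoch (q * c / e) q j / qpoch (q / q ^+ k * (c / e)) q j.
  by rewrite -shifted_powX mulfK.
have -> : qpoch (a * b * (c * q ^+ j) * f) q k =
    qpoch (a * b * c * f) q k * qpoch (a * b * c * f * q ^+ k) q j / qpoch (a * b * c * f) q j.
  rewrite -qpochD addnC qpochD [RHS]mulrAC divff // mul1r; congr (qpoch _ q k).
  by ring.
have H1 := qpochqq_neq0 hq k; have H2 := qpoch_neq0 k q0 hbe; have H3 := qpoch_neq0 k q0 hef.
have H4 := expf_neq0 k a0.
move: A0; rewrite -/(aw_par q a b e f); move: (aw_par _ _ _ _ _) => A A0.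
by field; rewrite R0 P1 P2 P3 A0 H1 H2 H3 H4.
Qed.

Lemma weight_askey_wilson k :
  c ^+ k * (qpoch (a * b * e * f) q (2 * k)
            * (qpoch (e / c) q k * qpoch (a * b * e * f / q) q k))
  / (qpoch (a * b * e * f / q) q (2 * k)
     * (qpoch q q k * qpoch (a * e) q k * qpoch (b * e) q k * qpoch (e * f) q k
        * qpoch (a * b * c * f) q k))
  * askey_wilson k x a b e f q = weight c k * phi k.
Proof.
rewrite (askey_wilson_phi _ _ _ _ _ z0 hx) /weight shifted_powE.
have A0 := one_sub_A hq hA.
have -> : qpoch (a * b * e * f) q (2 * k) =
    qpoch (a * b * e * f / q) q (2 * k) * (1 - a * b * e * f / q * q ^+ (2 * k))
     / (1 - a * b * e * f / q).
  by rewrite -qpochSr qpochS divfK // [RHS]mulrAC divff // mul1r.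
rewrite /aw_par; rewrite /aw_par in A0.
move: (phi k) => P.
have H1 := qpochqq_neq0 hq k; have H2 := qpoch_neq0 k q0 hbe; have H3 := qpoch_neq0 k q0 hef.
have H4 := expf_neq0 k a0; have H5 := qpoch_neq0 k q0 habcf; have H6 := qpoch_neq0 k q0 hae.
have H7 := qpoch_neq0 (2 * k) q0 hA.
move: (a * b * e * f / q) A0 H7 => A A0 H7.
by field; rewrite H1 H2 H3 H4 H5 H6 H7 A0.
Qed.

Definition Phi1 k := tphi43 q n (q ^+ n / q * a * b * c * d) (c * f) (q * c / e)
  (c * d) (q ^+ k * a * b * c * f) (q / q ^+ k * (c / e)).
Definition Phi2 k := tphi43 q k (q ^+ k / q * a * b * e * f) (c * f) (q * f / d)
  (e * f) (q ^+ n * a * b * c * f) (q / q ^+ n * (f / d)).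

Definition pref := qpochs_inf [:: a * e; b * e; e * f; a * b * c * f; c * z; c * z^-1] q
  / qpochs_inf [:: a * c; b * c; c * f; a * b * e * f; e * z; e * z^-1] q.

Lemma connection1 :
  csummable (fun k => c ^- n * (weight c k * phi k) * Phi1 k) /\
  askey_wilson n x a b c d q =
  pref * (qpoch (a * c) q n * qpoch (b * c) q n * qpoch (c * d) q n)
  * csum (fun k => c ^- n * (weight c k * phi k) * Phi1 k).
Proof.
have gc := admissible_disc hq z0 a0 hab hae haf hbe hef hA c0 cz cz' habcf.
(* Summing [F j k] over j gives the k-th term of the formula; summing it over k first gives, up to a
   common factor, the j-th term of p_n in the base (cz, c/z; q)_j. *)
pose kappa j := c ^- n * (qpoch (q ^- n) q j * qpoch (q ^+ n / q * a * b * c * d) q j * q ^+ j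
  / (qpoch q q j * qpoch (c * d) q j)) * (qpoch (c * f) q j / qpoch (a * b * c * f) q j).
pose F j k := kappa j * (weight (c * q ^+ j) k * phi k).
have uE k : \sum_(j < n.+1) F j k = c ^- n * (weight c k * phi k) * Phi1 k.
  rewrite [RHS]mulr_sumr; apply: eq_bigr => j _; rewrite /F /kappa.
  have H1 := qpochqq_neq0 hq j; have H2 := qpoch_neq0 j q0 hcd.
  have H3 := qpoch_neq0 j q0 (hce k); have H4 := qpoch_neq0 j q0 habcf.
  have H5 : qpoch (q ^+ k * a * b * c * f) q j != 0.
    have -> : q ^+ k * a * b * c * f = a * b * c * f * q ^+ k by ring.
    exact: qpoch_neq0 (qregularM _ _ _).
  have H6 := expf_neq0 n c0.
  set t1 := qpoch (q ^- n) q j; set t2 := qpoch (q ^+ n / q * a * b * c * d) q j.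
  set d1 := qpoch q q j; set d2 := qpoch (c * d) q j.
  transitivity (c ^- n * (t1 * t2 * q ^+ j / (d1 * d2))
     * (qpoch (c * f) q j / qpoch (a * b * c * f) q j * weight (c * q ^+ j) k) * phi k).
    by ring.
  rewrite weightX; move: (weight c k) (phi k) H1 H2 H3 H4 H5 H6; rewrite -/d1 -/d2.
  move: t1 t2 d1 d2 => t1 t2 d1 d2.
  move: (qpoch (c * f) q j) (qpoch (q * c / e) q j) => t3 t4.
  move: (qpoch _ q j) (qpoch _ q j) (qpoch _ q j) => d3 d4 d5 w p H1 H2 H3 H4 H5 H6.
  by field; rewrite H1 H2 H3 H5 H6.
have Fs j : csummable (F j) by exact: csummableZ (gc.1 j).
have lim := csum_sum (n := n.+1) Fs.
have su : series (fun k => \sum_(j < n.+1) F j k)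
    = series (fun k => c ^- n * (weight c k * phi k) * Phi1 k).
  by congr series; apply/funext.
rewrite su in lim.
split; first by apply/cvg_ex; exists (\sum_(j < n.+1) csum (F j)).
rewrite (csumE lim) (@askey_wilson_swap n x z a b c d z0 hx) // /tphi43 !mulr_sumr.
apply: eq_bigr => j _; rewrite csumZ; last exact: gc.1.
have := csum_shiftn hq z0 a0 hab hae haf hbe hef hA j habcf gc.
have [_ expand] := one_expansion hq z0 a0 hab hae haf hbe hef hA e0 c0 cz cz' habcf habef.
have nz : qpochs_inf [:: a * c; b * c; c * f; a * b * e * f; e * z; e * z^-1] q != 0.
  by rewrite /qpochs_inf !big_cons big_nil !mulf_neq0 ?oner_neq0 // (qpoch_inf_neq0 hq).
have prefS : pref * S c = 1 by rewrite /pref mulrAC expand divff.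
move: (csum (fun k => weight (c * q ^+ j) k * phi k)) => Sj h.
have H1 := qpochqq_neq0 hq j; have H2 := qpoch_neq0 j q0 hcd.
have H3 := qpoch_neq0 j q0 hac; have H4 := qpoch_neq0 j q0 habcf.
have H5 := qpoch_neq0 j q0 hbc; have H6 := expf_neq0 n c0.
have X : qpoch (c * z) q j * qpoch (c * z^-1) q j =
    pref * (qpoch (a * c) q j * qpoch (b * c) q j * qpoch (c * f) q j * Sj)
    / qpoch (a * b * c * f) q j.
  by rewrite -h mulrCA prefS mulr1 mulfK.
have -> : a * b * c * d / q * q ^+ n = q ^+ n / q * a * b * c * d by ring.
rewrite X /kappa.
move: (qpoch (q ^- n) q j) (qpoch (q ^+ n / q * a * b * c * d) q j) H1 H2 H3 H4 H5 H6.
move: (qpoch q q j) (qpoch (a * c) q j) (qpoch (b * c) q j) (qpoch (c * d) q j)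
  (qpoch (a * b * c * f) q j) (qpoch (c * f) q j) (qpoch (a * c) q n) (qpoch (b * c) q n)
  (qpoch (c * d) q n) pref.
move=> d1 d2 d3 d4 d5 t1 t2 t3 t4 p t5 t6 H1 H2 H3 H4 H5 H6.
by field; rewrite H1 H2 H3 H4 H5 H6.
Qed.

(** The exchange c <-> f, d <-> e, n <-> k takes one inner series to the other. [tphi43_double]
    applied to both produces series that differ only in which of q^-n, q^-k is taken as terminating,
    and [tphi43_exchange] identifies them. *)
Lemma Phi1_Phi2 k :
  c ^+ k * f ^+ k * (qpoch (c * d) q n * qpoch (e / c) q k * qpoch (a * b) q k
    * qpoch (a * b * c * f) q n) * Phi1 k
  = c ^+ n * f ^+ n * (qpoch (a * b) q n * qpoch (d / f) q n * qpoch (e * f) q k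
    * qpoch (a * b * c * f) q k) * Phi2 k.
Proof.
have h1 := tphi43_double a0 b0 c0 d0 e0 f0 hab hcd habcf (hce k) hfd.
have hfe : qregular q (f * e) by rewrite mulrC.
have habfc : qregular q (a * b * f * c) by rewrite mulrAC.
have h2 := tphi43_double a0 b0 f0 e0 d0 c0 hab hfe habfc hfd (hce k).
have E1 : a * b * f * c = a * b * c * f by ring.
have E2 : q ^+ n * a * b * f * c = q ^+ n * a * b * c * f by ring.
have E3 : q ^+ k / q * a * b * f * e = q ^+ k / q * a * b * e * f by ring.
have E4 : q ^+ n * q ^+ k * (a * b * e * d) = q ^+ k * q ^+ n * (a * b * d * e) by ring.
have E5 : a * b * q ^+ n * q ^+ k = a * b * q ^+ k * q ^+ n by ring.
rewrite E1 E2 E3 E4 E5 (mulrC f e) (mulrC f c) tphi43_exchange -/(Phi2 k) in h2.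
rewrite -/(Phi1 k) in h1; move: h1 h2.
set Y := tphi43 q n _ _ _ _ _ _ => h1 h2.
have s1 y : qpoch y q k * qpoch (y * q ^+ k) q n = qpoch y q n * qpoch (y * q ^+ n) q k.
  by rewrite -!qpochD addnC.
have P1 := qpoch_neq0 k q0 habcf; have P2 := qpoch_neq0 n q0 habcf.
apply: (mulIf (qpoch_neq0 n q0 (qregularM k q0 habcf))).
transitivity (c ^+ k * f ^+ k
   * (qpoch (e / c) q k * qpoch (a * b) q k * qpoch (a * b * c * f) q n)
   * (qpoch (c * d) q n * qpoch (a * b * c * f * q ^+ k) q n * Phi1 k)); first by ring.
rewrite h1.
transitivity (c ^+ n * f ^+ n * (qpoch (a * b) q n * qpoch (d / f) q n)
   * (qpoch (a * b * c * f) q k * qpoch (a * b * c * f * q ^+ k) q n)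
   * (qpoch (e * f) q k * Phi2 k)); last by ring.
rewrite s1.
transitivity (c ^+ n * f ^+ n * (qpoch (a * b) q n * qpoch (d / f) q n)
   * qpoch (a * b * c * f) q n
   * (qpoch (e * f) q k * qpoch (a * b * c * f * q ^+ n) q k * Phi2 k)); last by ring.
rewrite h2 !exprMn.
transitivity (c ^+ k * f ^+ k * c ^+ n * f ^+ n * qpoch (e / c) q k * qpoch (a * b * c * f) q n
   * qpoch (d / f) q n * Y * (qpoch (a * b) q k * qpoch (a * b * q ^+ k) q n)); first by ring.
by rewrite s1; ring.
Qed.

End Connection.
End Connecting.

Unset Implicit Arguments.

Theorem theorem6p1 (R : realType) (n : nat) (q z a b c d e f x : R[i])
  (hq : 0 < `|q| < 1)
  (hz : z != 0) (ha : a != 0) (hb : b != 0) (hc : c != 0)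
  (hd : d != 0) (he : e != 0) (hf : f != 0)
  (hcz : Num.max `|c * z| `|c / z| < 1)
  (hx : x = (z + z^-1) / 2)
  (* infinite products *)
  (hac : qregular q (a * c)) (hbc : qregular q (b * c))
  (hcf : qregular q (c * f)) (habef : qregular q (a * b * e * f))
  (hez : qregular q (e * z))
  (hezV : qregular q (e * z^-1))
  (* finite products *)
  (habefq : qregular q (a * b * e * f / q))
  (hab : qregular q (a * b)) (hae : qregular q (a * e))
  (hbe : qregular q (b * e)) (hef : qregular q (e * f))
  (habcf : qregular q (a * b * c * f))
  (* lower parameters of the 4phi3 series (habcf covers q^k abcf and q^n abcf) *)
  (hcd : qregular q (c * d))
  (hce : forall k : nat, qregular q (q ^ (1 - k%:Z) * (c / e)))
  (hfd : qregular q (q ^ (1 - n%:Z) * (f / d)))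
  (* lower parameters of the Askey-Wilson polynomials *)
  (had : qregular q (a * d)) (haf : qregular q (a * f)) :
  let pref := qpochs_inf [:: a * e; b * e; e * f; a * b * c * f;
                             c * z; c * z^-1] q
              / qpochs_inf [:: a * c; b * c; c * f; a * b * e * f;
                               e * z; e * z^-1] q in
  let u (k : nat) :=
    c ^ (k%:Z - n%:Z)
    * (qpoch (a * b * e * f) q (2 * k)
       * qpochs [:: e / c; a * b * e * f / q] q k)
    / (qpoch (a * b * e * f / q) q (2 * k)
       * qpochs [:: q; a * e; b * e; e * f; a * b * c * f] q k)
    * askey_wilson k x a b e f q
    * phi43 (q ^- n) (q ^ (n%:Z - 1) * a * b * c * d) (c * f) (q * c / e)
            (c * d) (q ^+ k * a * b * c * f) (q ^ (1 - k%:Z) * (c / e)) q q in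
  let v (k : nat) :=
    f ^ (n%:Z - k%:Z)
    * (qpoch (a * b * e * f) q (2 * k) * qpoch (a * b * e * f / q) q k)
    / (qpoch (a * b * e * f / q) q (2 * k)
       * qpochs [:: q; a * b; a * e; b * e] q k)
    * askey_wilson k x a b e f q
    * phi43 (q ^- k) (q ^ (k%:Z - 1) * a * b * e * f) (c * f) (q * f / d)
            (e * f) (q ^+ n * a * b * c * f) (q ^ (1 - n%:Z) * (f / d)) q q in
  (csummable u /\
   askey_wilson n x a b c d q
   = pref * qpochs [:: a * c; b * c; c * d] q n * csum u) /\
  (csummable v /\
   askey_wilson n x a b c d q
   = pref * (qpochs [:: a * b; a * c; b * c; d / f] q n
             / qpoch (a * b * c * f) q n) * csum v).
Proof.
have /andP[] := hq; rewrite normr_gt0 => q0 _.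
have [hcz1 hcz2] : normc (c * z) < 1 /\ normc (c * z^-1) < 1.
  move: hcz; rewrite comparable_gt_max ?real_comparable ?normr_real // => /andP[h1 h2].
  by rewrite -!ltcR.
have q1B (m : nat) : q ^ (1 - m%:Z) = q / q ^+ m by rewrite (exprzB 1 m) // expr1.
have qB1 (m : nat) : q ^ (m%:Z - 1) = q ^+ m / q by rewrite (exprzB m 1) // expr1.
have hce' k : qregular q (q / q ^+ k * (c / e)) by rewrite -q1B.
rewrite q1B in hfd.
move=> pref u v.
have [su eu] := connection1 hq n hz ha hc he hx hcz1 hcz2 hac hbc hcf habef hez hezV habefq
  hab hae hbe hef habcf hcd hce' had haf.
(* A zero factor, (d/f) q^i = 1 with i < n, would give q^(1-n) f/d = q^-(n-1-i), which [hfd]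
   excludes. *)
have nd : qpoch (d / f) q n != 0.
  apply/prodf_neq0 => i _; rewrite subr_eq0 eq_sym.
  have lt_in : (i < n)%N by [].
  apply: contra (hfd (n - i.+1)%N) => /eqP E; apply/eqP.
  have qE : q ^+ n = q ^+ (n - i.+1) * q ^+ i * q by rewrite -mulrA -exprSr -exprD subnK.
  have qi := expf_neq0 i q0; have qni := expf_neq0 (n - i.+1) q0.
  have -> : f / d = q ^+ i by rewrite -[f / d]mulr1 -E; field; rewrite hd hf.
  by rewrite qE; field; rewrite q0 qi qni.
have uE : u = fun k =>
    c ^- n * (weight q a b e f c k * aw_phi q z a b e f k) * Phi1 q n a b c d e f k.
  apply/funext => k.
  rewrite /u (exprzB k n hc) /qpochs !big_cons !big_nil !mulr1 phi43E // qB1 q1B.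
  by rewrite -(weight_askey_wilson hq hz ha hc hx) // /Phi1 !invfM; ring.
(* The ratio of the two summands does not depend on k, so the second formula and its convergence
   follow from the first. *)
have vE : v = fun k => (qpoch (c * d) q n * qpoch (a * b * c * f) q n
    / (qpoch (a * b) q n * qpoch (d / f) q n)) * u k.
  apply/funext => k.
  rewrite /v /u (exprzB n k hf) (exprzB k n hc) /qpochs !big_cons !big_nil.
  rewrite !mulr1 !phi43E // !qB1 !q1B.
  have := Phi1_Phi2 hq ha hb hc hd he hf hab hef habcf hcd hce' hfd k.
  rewrite /Phi1 /Phi2.
  move: (tphi43 _ _ _ _ _ _ _ _) (tphi43 _ _ _ _ _ _ _ _) => P2 P1 h.
  have N1 := expf_neq0 n hc; have N2 := expf_neq0 n hf; have N3 := expf_neq0 k hf.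
  have N4 := qpoch_neq0 n q0 hab; have N5 := qpoch_neq0 k q0 hab.
  have N6 := qpoch_neq0 k q0 hef; have N7 := qpoch_neq0 k q0 habcf.
  have N8 := qpoch_neq0 k q0 hae; have N9 := qpoch_neq0 k q0 hbe.
  have N10 := qpochqq_neq0 hq k; have N11 := qpoch_neq0 (2 * k) q0 habefq.
  pose D := c ^+ n * f ^+ n * (qpoch (a * b) q n * qpoch (d / f) q n
    * qpoch (e * f) q k * qpoch (a * b * c * f) q k).
  have D0 : D != 0 by rewrite /D !mulf_neq0.
  have -> : P2 = c ^+ k * f ^+ k * (qpoch (c * d) q n * qpoch (e / c) q k
      * qpoch (a * b) q k * qpoch (a * b * c * f) q n) * P1 / D.
    by rewrite h -/D mulrAC divff // mul1r.
  rewrite /D.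
  move: (askey_wilson _ _ _ _ _ _ _) (qpoch (a * b * e * f) q (2 * k))
    (qpoch (a * b * e * f / q) q (2 * k)) N11 => W t1 d1 N11.
  by field; rewrite N7 N6 N9 N8 N10 N11 N1 nd N4 N2 N5 N3.
have absum : pref * qpochs [:: a * c; b * c; c * d] q n * csum u =
    pref * (qpochs [:: a * b; a * c; b * c; d / f] q n / qpoch (a * b * c * f) q n) * csum v.
  rewrite vE csumZ; last by rewrite uE.
  rewrite /qpochs !big_cons !big_nil.
  by field; rewrite nd (qpoch_neq0 n q0 hab) (qpoch_neq0 n q0 habcf).
have E : askey_wilson n x a b c d q = pref * qpochs [:: a * c; b * c; c * d] q n * csum u.
  by rewrite eu uE /qpochs [in RHS]/= !big_cons !big_nil !mulr1 !mulrA.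
have su' : csummable u by rewrite uE.
split; split; [exact: su'|exact: E| |rewrite -absum; exact: E].
by rewrite vE; exact: csummableZ.
Qed.
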